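(* There exists a continuous field $((A(t))_{t\in[0,1]},\Gamma)$ of postliminal $C^*$-algebras over $[0,1]$ whose fibers $A(t)$ are mutually isomorphic and such that, for every non-empty relatively open subset $U$ of $[0,1]$, the restriction of the field to $U$ is not tame.
   Context: Ideals of $C^*$-algebras are closed and two-sided. A $C^*$-algebra is liminal (CCR) if every irreducible representation maps it into the compact operators; it is postliminal (GCR) if every nonzero quotient has a nonzero liminal ideal. Every $C^*$-algebra has a greatest liminal ideal. Continuous fields (Dixmier). A continuous field of $C^*$-algebras over a topological space $T$ is a pair $((E(t))_{t\in T},\Gamma)$, where each $E(t)$ is a $C^*$-algebra and $\Gamma$ is a linear subspace of $\prod_{t\in T}E(t)$, closed under pointwise multiplication and involution, such that: (i) for every $t\in T$ the set $\{x(t)\mid x\in\Gamma\}$ is dense in $E(t)$ (it is then automatically all of $E(t)$); (ii) for every $x\in\Gamma$ the function $t\mapsto\|x(t)\|$ is continuous; (iii) if $x\in\prod_{t}E(t)$ is such that for every $t\in T$ and $\varepsilon>0$ there is $y\in\Gamma$ with $\|x(s)-y(s)\|\le\varepsilon$ for all $s$ in some neighborhood of $t$, then $x\in\Gamma$. The restriction of $((E(t)),\Gamma)$ to an open set $U\subset T$ is $((E(t))_{t\in U},\Gamma|_U)$, where $\Gamma|_U$ is the set of all $x\in\prod_{t\in U}E(t)$ that can be approximated, near every point of $U$ and to within every $\varepsilon>0$ as in (iii), by restrictions to $U$ of elements of $\Gamma$. A continuous field $((A(t))_{t\in T},\Theta)$ of postliminal $C^*$-algebras is called tame if, with $B(t)$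 the greatest liminal ideal of $A(t)$ and $\Theta' := \{x\in\Theta\mid x(t)\in B(t)\ \text{for all}\ t\in T\}$, the pair $((B(t)),\Theta')$ is a continuous field of $C^*$-algebras. *)

(* Defs.v *)
From HB Require Import structures.
From mathcomp Require Import all_boot all_order all_algebra.
From mathcomp Require Import complex.
From mathcomp Require Import all_classical all_reals all_analysis.

Set Implicit Arguments.
Unset Strict Implicit.
Unset Printing Implicit Defensive.

Import Order.TTheory GRing.Theory Num.Theory.
Import numFieldNormedType.Exports.

Local Open Scope classical_set_scope.
Local Open Scope ring_scope.

(* The norm of a normed space over R[i] is a nonnegative element of R[i];
   this is the same norm as an element of R. *)
Definition rnorm (R : realType) (V : normedModType R[i]) (x : V) : R :=
  complex.Re `|x|.

(* C*-algebras are not assumed to be unital, and the zero algebra is allowed. *)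
HB.mixin Record CompleteNormedModule_isCStarAlgebra (R : realType) A
    & CompleteNormedModule R[i] A := {
  cmul : A -> A -> A ;
  adj : A -> A ;
  cmulA : associative cmul ;
  cmulDl : left_distributive cmul +%R ;
  cmulDr : right_distributive cmul +%R ;
  cmulZl : forall (k : R[i]) (x y : A), cmul (k *: x) y = k *: cmul x y ;
  cmulZr : forall (k : R[i]) (x y : A), cmul x (k *: y) = k *: cmul x y ;
  cnormM : forall x y : A, `|cmul x y| <= `|x| * `|y| ;
  adjK : involutive adj ;
  adjD : {morph adj : x y / x + y} ;
  adjZ : forall (k : R[i]) (x : A), adj (k *: x) = Num.conj k *: adj x ;
  adjM : forall x y : A, adj (cmul x y) = cmul (adj y) (adj x) ;
  cnorm_adjM : forall x : A, `|cmul (adj x) x| = `|x| ^+ 2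
}.

#[short(type="cstarAlgType")]
HB.structure Definition CStarAlgebra (R : realType) :=
  {A of CompleteNormedModule_isCStarAlgebra R A & CompleteNormedModule R[i] A}.

HB.mixin Record CompleteNormedModule_isHilbert (R : realType) H
    & CompleteNormedModule R[i] H := {
  hdot : {dot H for (@Num.conj R[i])} ;
  hdot_norm : forall u : H, `|u| ^+ 2 = hdot u u
}.

#[short(type="hilbertType")]
HB.structure Definition Hilbert (R : realType) :=
  {H of CompleteNormedModule_isHilbert R H & CompleteNormedModule R[i] H}.

Definition lin_subspace (K : numFieldType) (V : lmodType K) (S : set V) : Prop :=
  S 0 /\ forall (k : K) (x y : V), S x -> S y -> S (k *: x + y).

Definition star_morphism (R : realType) (A B : cstarAlgType R)
    (f : A -> B) : Prop :=
  [/\ forall (k : R[i]) (x y : A), f (k *: x + y) = k *: f x + f y,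
      forall x y : A, f (cmul x y) = cmul (f x) (f y) &
      forall x : A, f (adj x) = adj (f x)].

Definition isomorphic (R : realType) (A B : cstarAlgType R) : Prop :=
  exists f : A -> B, star_morphism f /\ bijective f.

Definition closed_ideal (R : realType) (A : cstarAlgType R)
    (J : set A) : Prop :=
  [/\ lin_subspace J,
      forall a x : A, J x -> J (cmul a x),
      forall a x : A, J x -> J (cmul x a) &
      closed J].

Record csubalg (R : realType) (A : cstarAlgType R) := CSubalg {
  csubalg_set :> set A ;
  csubalg_lin : lin_subspace csubalg_set ;
  csubalg_mul : forall x y : A,
    csubalg_set x -> csubalg_set y -> csubalg_set (cmul x y) ;
  csubalg_adj : forall x : A, csubalg_set x -> csubalg_set (adj x) ;
  csubalg_closed : closed csubalg_set
}.

(* A C*-subalgebra, with the inherited operations and norm, as a C*-algebra. *)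
Definition csub (R : realType) (A : cstarAlgType R) (J : csubalg A) : Type :=
  {x : A | x \in csubalg_set J}.

Section CSub.
Context (R : realType) (A : cstarAlgType R) (J : csubalg A).

HB.instance Definition _ := [isSub of csub J for @sval A _].
HB.instance Definition _ := [Choice of csub J by <:].

Lemma csub_subproof : subsemimod_closed (mem (csubalg_set J)).
Proof.
have [J0 JD] := csubalg_lin J.
split; first split.
- exact/mem_set.
- move=> x y /set_mem Jx /set_mem Jy; apply/mem_set.
  by rewrite -[x]scale1r; apply: JD.
- move=> k x /set_mem Jx; apply/mem_set; rewrite -[_ *: _]addr0; exact: JD.
Qed.

HB.instance Definition _ :=
  GRing.SubChoice_isSubLmodule.Build R[i] A (mem (csubalg_set J)) (csub J)
    csub_subproof.

Let csub_norm (x : csub J) : R[i] := `|val x|.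

Lemma csub_normD (x y : csub J) :
  csub_norm (x + y) <= csub_norm x + csub_norm y.
Proof. by rewrite /csub_norm raddfD ler_normD. Qed.

Lemma csub_normZ (l : R[i]) (x : csub J) :
  csub_norm (l *: x) = `|l| * csub_norm x.
Proof. by rewrite /csub_norm linearZ/= normrZ. Qed.

Lemma csub_norm0 (x : csub J) : csub_norm x = 0 -> x = 0.
Proof.
by move=> /normr0_eq0 x0; apply: val_inj; rewrite x0 raddf0.
Qed.

HB.instance Definition _ :=
  Lmodule_isNormed.Build R[i] (csub J) csub_normD csub_normZ csub_norm0.

Lemma csub_complete (F : set_system (csub J)) :
  ProperFilter F -> cauchy F -> cvg F.
Proof.
move=> FF /cauchy_ballP Fc.
have Gc : cauchy (val @ F : set_system A).
  apply/cauchy_ballP => e e0.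
  have [/= [P Q] [FP FQ] PQ] := Fc e e0.
  exists (val @` P, val @` Q) => /=.
    by split; [apply: filterS FP|apply: filterS FQ] => x Px; exists x.
  move=> -[_ _] /= [[x Px <-] [y Qy <-]].
  by have := PQ (x, y) (conj Px Qy); rewrite -!ball_normE /ball_/= /Num.norm/=.
have /cvg_ex[/= l Gl] : cvg (val @ F : set_system A) by exact: cauchy_cvg.
have Jl : (l \in csubalg_set J).
  apply/mem_set.
  have := @closed_cvg _ _ F FF (sval : csub J -> A) (csubalg_set J)
    (@csubalg_closed _ _ J).
  by apply=> //; apply: nearW => x; apply/set_mem/(valP x).
apply/cvg_ex; exists (exist _ l Jl).
apply/cvgrPdist_lt => e e0.
move/cvgrPdist_lt : Gl => /(_ e e0); apply: filterS => x.
by rewrite {2}/Num.norm/=.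
Qed.

HB.instance Definition _ := Uniform_isComplete.Build (csub J) csub_complete.

Lemma csub_mulP (x y : csub J) : cmul (val x) (val y) \in csubalg_set J.
Proof. by apply/mem_set/csubalg_mul; apply/set_mem; exact: valP. Qed.

Lemma csub_adjP (x : csub J) : adj (val x) \in csubalg_set J.
Proof. by apply/mem_set/csubalg_adj/set_mem; exact: valP. Qed.

Let csub_mul (x y : csub J) : csub J := exist _ (cmul (val x) (val y)) (csub_mulP x y).
Let csub_adj (x : csub J) : csub J := exist _ (adj (val x)) (csub_adjP x).

Let csub_mulA : associative csub_mul.
Proof. by move=> x y z; apply: val_inj; exact: cmulA. Qed.
Let csub_mulDl : left_distributive csub_mul +%R.
Proof. by move=> x y z; apply: val_inj; exact: cmulDl. Qed.
Let csub_mulDr : right_distributive csub_mul +%R.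
Proof. by move=> x y z; apply: val_inj; exact: cmulDr. Qed.
Let csub_mulZl (k : R[i]) x y : csub_mul (k *: x) y = k *: csub_mul x y.
Proof. by apply: val_inj; exact: cmulZl. Qed.
Let csub_mulZr (k : R[i]) x y : csub_mul x (k *: y) = k *: csub_mul x y.
Proof. by apply: val_inj; exact: cmulZr. Qed.
Let csub_normM x y : `|csub_mul x y| <= `|x| * `|y|.
Proof. exact: cnormM. Qed.
Let csub_adjK : involutive csub_adj.
Proof. by move=> x; apply: val_inj; exact: adjK. Qed.
Let csub_adjD : {morph csub_adj : x y / x + y}.
Proof. by move=> x y; apply: val_inj; exact: adjD. Qed.
Let csub_adjZ (k : R[i]) x : csub_adj (k *: x) = Num.conj k *: csub_adj x.
Proof. by apply: val_inj; exact: adjZ. Qed.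
Let csub_adjM x y : csub_adj (csub_mul x y) = csub_mul (csub_adj y) (csub_adj x).
Proof. by apply: val_inj; exact: adjM. Qed.
Let csub_norm_adjM x : `|csub_mul (csub_adj x) x| = `|x| ^+ 2.
Proof. exact: cnorm_adjM. Qed.

HB.instance Definition _ :=
  CompleteNormedModule_isCStarAlgebra.Build R (csub J)
    csub_mulA csub_mulDl csub_mulDr csub_mulZl csub_mulZr csub_normM
    csub_adjK csub_adjD csub_adjZ csub_adjM csub_norm_adjM.

End CSub.

Record representation (R : realType) (A : cstarAlgType R)
    (H : hilbertType R) := Representation {
  rep :> A -> H -> H ;
  rep_linear : forall (a : A) (k : R[i]) (u v : H),
    rep a (k *: u + v) = k *: rep a u + rep a v ;
  rep_continuous : forall a : A, continuous (rep a) ;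
  repD : forall (k : R[i]) (a b : A) (u : H),
    rep (k *: a + b) u = k *: rep a u + rep b u ;
  repM : forall (a b : A) (u : H), rep (cmul a b) u = rep a (rep b u) ;
  rep_adj : forall (a : A) (u v : H), hdot (rep a u) v = hdot u (rep (adj a) v)
}.

Definition irreducible (R : realType) (A : cstarAlgType R) (H : hilbertType R)
    (p : representation A H) : Prop :=
  (exists u : H, u != 0) /\
  forall S : set H, lin_subspace S -> closed S ->
    (forall (a : A) (u : H), S u -> S (p a u)) -> S = [set 0] \/ S = setT.

Definition compact_operator (R : realType) (H : hilbertType R)
    (f : H -> H) : Prop :=
  precompact (f @` [set u | `|u| <= 1]).

Definition liminal (R : realType) (A : cstarAlgType R) : Prop :=
  forall (H : hilbertType R) (p : representation A H), irreducible p ->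
    forall a : A, compact_operator (p a).

(* Every closed ideal is self-adjoint, hence a C*-subalgebra, so nothing is lost
   by quantifying over C*-subalgebras here. *)
Definition liminal_ideal (R : realType) (A : cstarAlgType R)
    (J : csubalg A) : Prop :=
  closed_ideal J /\ liminal (csub J).

Definition greatest_liminal_ideal (R : realType) (A : cstarAlgType R)
    (B : csubalg A) : Prop :=
  liminal_ideal B /\ forall J : csubalg A, liminal_ideal J -> J `<=` B.

(* q : A -> Q presents the C*-algebra Q as the quotient A / J: it is a surjective
   *-morphism with kernel J, and Q carries the quotient norm.  Such a pair (Q, q) exists for every
   closed ideal J and is unique up to isometric *-isomorphism. *)
Definition is_quotient (R : realType) (A Q : cstarAlgType R)
    (J : set A) (q : A -> Q) : Prop :=
  [/\ star_morphism q,
      forall z : Q, exists a : A, q a = z,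
      forall a : A, q a = 0 <-> J a &
      forall a : A, rnorm (q a) = inf [set rnorm (a + j) | j in J]].

Definition postliminal (R : realType) (A : cstarAlgType R) : Prop :=
  forall (J : set A) (Q : cstarAlgType R) (q : A -> Q),
    closed_ideal J -> is_quotient J q -> (exists z : Q, z != 0) ->
    exists L : csubalg Q, liminal_ideal L /\ exists z : Q, csubalg_set L z /\ z != 0.

Definition locally_approx (R : realType) (S : topologicalType)
    (E : S -> cstarAlgType R) (G : set (forall s, E s)) :
    set (forall s, E s) :=
  [set x | forall (t : S) (e : R), 0 < e -> exists y, G y /\
    \forall s \near t, rnorm (x s - y s) <= e].

Record continuous_field (R : realType) (T : topologicalType)
    (E : T -> cstarAlgType R) (G : set (forall t, E t)) : Prop :=
  ContinuousField {
  cfield_0 : G (fun t => 0) ;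
  cfield_lin : forall (k : R[i]) (x y : forall t, E t),
    G x -> G y -> G (fun t => k *: x t + y t) ;
  cfield_mul : forall x y : forall t, E t,
    G x -> G y -> G (fun t => cmul (x t) (y t)) ;
  cfield_adj : forall x : forall t, E t, G x -> G (fun t => adj (x t)) ;
  cfield_dense : forall t : T, dense [set x t | x in G] ;
  cfield_norm : forall x : forall t, E t,
    G x -> continuous (fun t => rnorm (x t)) ;
  cfield_local : locally_approx G `<=` G
}.

Definition restriction (R : realType) (T : topologicalType)
    (E : T -> cstarAlgType R) (G : set (forall t, E t)) (U : set T) :
    set (forall t : U, E (set_val t)) :=
  locally_approx [set (fun t : U => x (set_val t)) | x in G].
Arguments restriction {R T E} G U _.

(* B is unique, since greatest_liminal_ideal determines each B t as a set. *)
Definition tame (R : realType) (T : topologicalType)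
    (A : T -> cstarAlgType R) (G : set (forall t, A t)) : Prop :=
  exists B : forall t, csubalg (A t),
    (forall t, greatest_liminal_ideal (B t)) /\
    continuous_field (E := fun t => csub (B t))
      [set x | G (fun t => val (x t))].

(* Main.v *)
Require Import Defs.
From HB Require Import structures.
From mathcomp Require Import all_boot all_order all_algebra.
From mathcomp Require Import complex.
From mathcomp Require Import all_classical all_reals all_analysis.
From mathcomp Require Import ring lra.

Set Implicit Arguments.
Unset Strict Implicit.
Unset Printing Implicit Defensive.

Import Order.TTheory GRing.Theory Num.Theory.
Import numFieldNormedType.Exports.

Local Open Scope classical_set_scope.
Local Open Scope ring_scope.

(** Let $H=\ell^2$, and let $D$ be the $c_0$-direct sum of copies of
    $\mathbb C1+K(H)$ indexed by the points $r$ of $[0,1]$. The fiber $A(t)$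
    consists of the elements of $D$ whose component at $t$ is a scalar
    ([fiber]). Exchanging the components $s$ and $t$ is an isomorphism of $A(s)$
    onto $A(t)$ ([fiber_isomorphic]). The sections are the norm-continuous ones;
    there are enough of them because a compact operator in component $r$ may be
    multiplied by a continuous function vanishing at $r$ ([sections_field]).

    The identity $1_t$ of component $t$ spans a one-dimensional ideal of $A(t)$,
    so it lies in the greatest liminal ideal $B(t)$ ([comp1_liminal]). For
    $s\neq t$, however, component $t$ of $A(s)$ is all of $\mathbb C1+K(H)$, and an
    element of $B(s)$ acts compactly there; hence it has distance at least $1/4$
    from $1_t$ ([liminal_far_from_comp1]). A section of the ideals $B$ through a
    point near $1_t$ would be near $1_t$ at some $s\neq t$. So the field is tame on
    no open set ([sections_not_tame]).

    Liminality is always obtained from one criterion ([liminal_of_corners]): it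
    suffices that the algebra is the closed span of elements $e$ such that every
    $exe$ is a multiple of $e$. In an irreducible representation such an element
    has rank at most one, and representations are bounded. Both the rank-one
    operators and, once these vanish, the identities $1_r$ are of this kind in
    every quotient of $A(t)$, so $A(t)$ is postliminal ([fiber_postliminal]). *)

(** * Complex scalars and real-valued norms *)

Section ComplexModulus.
Variable R : realType.
Implicit Types (z : R[i]) (r : R).

Definition cmod z : R := complex.Re `|z|.

Lemma cmodE z : `|z| = (cmod z)%:C%C. Proof. by []. Qed.

Lemma cmod_ge0 z : 0 <= cmod z.
Proof. by have := normr_ge0 z; rewrite cmodE ler0c. Qed.

Lemma cmodD z w : cmod (z + w) <= cmod z + cmod w.
Proof. by have := ler_normD z w; rewrite !cmodE -rmorphD/= lecR. Qed.

Lemma cmodM z w : cmod (z * w) = cmod z * cmod w.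
Proof. by apply: complexI; rewrite rmorphM/= -!cmodE normrM. Qed.

Lemma cmodN z : cmod (- z) = cmod z.
Proof. by rewrite /cmod normrN. Qed.

Lemma cmod0 : cmod 0 = 0.
Proof. by rewrite /cmod normr0. Qed.

Lemma cmod_eq0 z : (cmod z == 0) = (z == 0).
Proof. by rewrite -[RHS]normr_eq0 cmodE -(inj_eq (@complexI R)). Qed.

Lemma cmod_real r : cmod r%:C%C = `|r|.
Proof. by rewrite /cmod normc_def/= expr0n/= addr0 sqrtr_sqr. Qed.

Lemma cmodV z : cmod z^-1 = (cmod z)^-1.
Proof. by apply: complexI; rewrite fmorphV/= -!cmodE normfV. Qed.

Lemma cmod_sqr z : cmod z ^+ 2 = complex.Re z ^+ 2 + complex.Im z ^+ 2.
Proof. by apply: complexI; rewrite rmorphXn/= -cmodE -add_Re2_Im2. Qed.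

Lemma cmod_conj z : cmod (Num.conj z) = cmod z.
Proof. by rewrite /cmod norm_conjC. Qed.

Lemma Re_le_cmod z : `|complex.Re z| <= cmod z.
Proof.
by rewrite -ler_sqr ?nnegrE ?cmod_ge0// real_normK ?num_real// cmod_sqr lerDl sqr_ge0.
Qed.

Lemma Im_le_cmod z : `|complex.Im z| <= cmod z.
Proof.
by rewrite -ler_sqr ?nnegrE ?cmod_ge0// real_normK ?num_real// cmod_sqr lerDr sqr_ge0.
Qed.

Lemma cmod_le_ReIm z : cmod z <= `|complex.Re z| + `|complex.Im z|.
Proof.
rewrite -ler_sqr ?nnegrE ?addr_ge0 ?cmod_ge0// cmod_sqr sqrrD.
rewrite !real_normK ?num_real//.
by rewrite -addrA lerD2l lerDr mulrn_wge0// mulr_ge0.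
Qed.

Lemma mul_conj_cmod z : z * Num.conj z = (cmod z ^+ 2)%:C%C.
Proof. by rewrite -normCK rmorphXn. Qed.

Lemma gtc0_real z : 0 < z -> z = (complex.Re z)%:C%C /\ 0 < complex.Re z.
Proof.
by case: z => a b; rewrite ltcE/= => /andP[/eqP-> a0]; split.
Qed.

End ComplexModulus.

Section RealNorm.
Variables (R : realType) (V : normedModType R[i]).
Implicit Types (x y z : V) (k : R[i]) (r : R).

Lemma rnormE x : `|x| = (rnorm x)%:C%C.
Proof. by rewrite /rnorm RRe_real// ger0_real. Qed.

Lemma rnorm_ge0 x : 0 <= rnorm x.
Proof. by have := normr_ge0 x; rewrite rnormE ler0c. Qed.

Lemma rnormD x y : rnorm (x + y) <= rnorm x + rnorm y.
Proof. by have := ler_normD x y; rewrite !rnormE -rmorphD/= lecR. Qed.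

Lemma rnormN x : rnorm (- x) = rnorm x.
Proof. by rewrite /rnorm normrN. Qed.

Lemma rnormB x y : rnorm (x - y) = rnorm (y - x).
Proof. by rewrite -rnormN opprB. Qed.

Lemma rnorm_tri z x y : rnorm (x - y) <= rnorm (x - z) + rnorm (z - y).
Proof. by rewrite -{1}(subrK z x) -addrA rnormD. Qed.

Lemma rnorm_tri4 (e : R) x y x' y' : 0 < e -> rnorm (x - x') <= e / 4 ->
  rnorm (y - y') <= e / 4 -> rnorm (x' - y') < e / 4 -> rnorm (x - y) < e.
Proof.
move=> e0 xx' yy' xy'; apply: le_lt_trans (rnorm_tri x' _ _) _.
by have := rnorm_tri y' x' y; rewrite (rnormB y' y); lra.
Qed.

Lemma rnorm_chain4 (e : R) x y z v w : rnorm (x - y) <= e ->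
  rnorm (y - z) < e -> rnorm (z - v) <= e -> rnorm (v - w) < e ->
  rnorm (x - w) < 4 * e.
Proof.
have := rnorm_tri y x w; have := rnorm_tri z y w; have := rnorm_tri v z w.
lra.
Qed.

Lemma rnorm0 : rnorm (0 : V) = 0.
Proof. by rewrite /rnorm normr0. Qed.

Lemma rnorm_eq0 x : (rnorm x == 0) = (x == 0).
Proof. by rewrite -[RHS]normr_eq0 rnormE -(inj_eq (@complexI R)). Qed.

Lemma rnorm_gt0 x : (0 < rnorm x) = (x != 0).
Proof. by rewrite lt_def rnorm_eq0 rnorm_ge0 andbT. Qed.

Lemma rnormZ k x : rnorm (k *: x) = cmod k * rnorm x.
Proof. by apply: complexI; rewrite rmorphM/= -cmodE -!rnormE normrZ. Qed.

Lemma rnorm_le x r : (`|x| <= r%:C%C) = (rnorm x <= r).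
Proof. by rewrite rnormE lecR. Qed.

Lemma rnorm_lt x r : (`|x| < r%:C%C) = (rnorm x < r).
Proof. by rewrite rnormE ltcR. Qed.

Lemma rnorm_lip x y : `|rnorm x - rnorm y| <= rnorm (x - y).
Proof.
rewrite ler_distl lerBlDr; apply/andP; split.
  by rewrite rnormB -[X in rnorm X <= _](subrK x) addrC rnormD.
by rewrite -[X in rnorm X <= _](subrK y) addrC rnormD.
Qed.

Lemma cvg_rnormP (T : Type) (F : set_system T) (FF : Filter F) (f : T -> V) (l : V) :
  f @ F --> l <-> forall e : R, 0 < e -> \forall x \near F, rnorm (l - f x) < e.
Proof.
split=> [/cvgrPdist_lt h e e0|h].
  have e0' : 0 < e%:C%C :> R[i] by rewrite ltcR.
  by apply: filterS (h _ e0') => x; rewrite rnorm_lt.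
apply/cvgrPdist_lt => e /gtc0_real[-> e0].
by apply: filterS (h _ e0) => x; rewrite rnorm_lt.
Qed.

Lemma nbhs_rnormP x (S : set V) :
  nbhs x S <-> exists2 e : R, 0 < e & forall y, rnorm (x - y) < e -> S y.
Proof.
split.
  move=> /nbhs_ballP[e /gtc0_real[-> e0] eS]; exists (complex.Re e) => // y xy.
  by apply: eS; rewrite -ball_normE/= rnorm_lt.
move=> [e e0 eS]; apply/nbhs_ballP; exists e%:C%C; first by rewrite /= ltcR.
by move=> y; rewrite -ball_normE/= rnorm_lt; apply: eS.
Qed.

Lemma closure_rnormP (S : set V) x :
  closure S x <-> forall e : R, 0 < e -> exists2 y, S y & rnorm (x - y) < e.
Proof.
split=> [cS e e0|h B /nbhs_rnormP[e e0 eB]].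
  have [|y [Sy xy]] := cS [set y | rnorm (x - y) < e]; last by exists y.
  by apply/nbhs_rnormP; exists e.
by have [y Sy xy] := h _ e0; exists y; split => //; exact: eB.
Qed.

Lemma closed_rnormP (S : set V) : closed S <->
  forall x, (forall e : R, 0 < e -> exists2 y, S y & rnorm (x - y) < e) -> S x.
Proof.
by split=> [cS x /closure_rnormP/cS//|h x /closure_rnormP]; exact: h.
Qed.

Lemma cauchy_rnormP (F : set_system V) (FF : ProperFilter F) :
  cauchy F <-> forall e : R, 0 < e -> exists x, \forall y \near F, rnorm (x - y) < e.
Proof.
split=> [/cauchyP cF e e0|h].
  have e0' : 0 < e%:C%C :> R[i] by rewrite ltcR.
  have [x xF] := cF _ e0'; exists x; apply: filterS xF => y.
  by rewrite -ball_normE/= rnorm_lt.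
apply/cauchyP => e /gtc0_real[-> e0].
have [x xF] := h _ e0; exists x; apply: filterS xF => y.
by rewrite -ball_normE/= rnorm_lt.
Qed.

Lemma dense_rnormP (S : set V) :
  (forall x (e : R), 0 < e -> exists2 y, S y & rnorm (x - y) < e) -> dense S.
Proof.
move=> h O [x Ox] Oo.
have /nbhs_rnormP[e e0 eO] : nbhs x O by exact: open_nbhs_nbhs.
by have [y Sy xy] := h x _ e0; exists y; split => //; exact: eO.
Qed.

Lemma dense_rnorm (S : set V) : dense S ->
  forall x (e : R), 0 < e -> exists2 y, S y & rnorm (x - y) < e.
Proof.
move=> dS x e e0; have [||y []] := dS (ball x e%:C%C).
- by exists x; apply: ballxx; rewrite ltcR.
- by apply: ball_open; rewrite ltcR.
- by rewrite -ball_normE/= rnorm_lt => xy Sy; exists y.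
Qed.

End RealNorm.

Section Lipschitz.
Variables (R : realType) (V W : normedModType R[i]).

Lemma rnorm_lipschitz_continuous (f : V -> W) (M : R) :
  (forall x y, rnorm (f x - f y) <= M * rnorm (x - y)) -> continuous f.
Proof.
move=> fM x; apply/cvg_rnormP => e e0.
have M0 : 0 < `|M| + 1 by rewrite ltr_wpDl.
apply/nbhs_rnormP; exists (e / (`|M| + 1)); first by rewrite divr_gt0.
move=> y; rewrite ltr_pdivlMr// => xy; apply: le_lt_trans (fM _ _) _.
apply: le_lt_trans _ xy; rewrite mulrC ler_wpM2l ?rnorm_ge0//.
by rewrite (le_trans (ler_norm _))// lerDl.
Qed.

Lemma continuous_rnorm (T : topologicalType) (f : T -> V) :
  continuous f -> continuous (fun t => rnorm (f t)).
Proof.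
move=> fc t; apply/cvgrPdist_lt => e e0.
have /cvg_rnormP/(_ _ e0) := fc t; apply: filterS => s.
exact/le_lt_trans/rnorm_lip.
Qed.

End Lipschitz.

Section ClosedLines.
Variables (R : realType) (V : normedModType R[i]).

Lemma compact_disc_line (M : R) (v : V) :
  exists2 K : set V, compact K & (forall k, cmod k <= M -> K (k *: v)) /\
    (forall x, K x -> exists k, x = k *: v).
Proof.
pose f (p : R * R) : V := (p.1 +i* p.2)%C *: v.
have fc : continuous f.
  move=> p; apply/cvg_rnormP => e e0.
  pose d := e / (2 * (rnorm v + 1)).
  have n0 : 0 < rnorm v + 1 by rewrite ltr_wpDl ?rnorm_ge0.
  have d0 : 0 < d by rewrite divr_gt0// mulr_gt0.
  have : nbhs p (ball p d) by exact: nbhsx_ballx.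
  apply: filterS => q [/= h1 h2].
  rewrite /f -scalerBl rnormZ.
  have kd : cmod ((p.1 +i* p.2)%C - (q.1 +i* q.2)%C) <= d + d.
    apply: le_trans (cmod_le_ReIm _) _.
    by move: h1 h2; rewrite -!ball_normE /= => h1 h2; rewrite lerD// ltW.
  apply: (@le_lt_trans _ _ ((d + d) * rnorm v)).
    by rewrite ler_wpM2r ?rnorm_ge0.
  have -> : d + d = e / (rnorm v + 1) by rewrite /d; field; rewrite gt_eqF.
  by rewrite mulrAC ltr_pdivrMr// ltr_pM2l// ltrDl.
exists (f @` (`[- M, M]%classic `*` `[- M, M]%classic)).
  apply: continuous_compact; first exact: continuous_subspaceT.
  by apply: compact_setX; apply: segment_compact.
split; last by move=> _ [[a b] _ <-]; exists (a +i* b)%C.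
move=> [a b] kM; exists (a, b) => //.
split; rewrite /= in_itv/= -ler_norml; apply: le_trans _ kM.
  exact: (Re_le_cmod (a +i* b)%C).
exact: (Im_le_cmod (a +i* b)%C).
Qed.

(** A point of the closure is a limit of multiples with bounded coefficients,
    so it lies in the closure of a compact part of the line. *)
Lemma closed_line (v : V) : closed [set x | exists k : R[i], x = k *: v].
Proof.
have [->|v0] := eqVneq v 0.
  apply/closed_rnormP => x h; exists 0; rewrite scaler0; apply/eqP.
  rewrite -rnorm_eq0; apply/eqP/le_anti; rewrite rnorm_ge0 andbT.
  apply/ler_addgt0Pl => e e0; have [_ [k ->]] := h _ e0.
  by rewrite scaler0 subr0 addr0 => /ltW.
apply/closed_rnormP => x h.
have [K Kc [K1 K2]] := compact_disc_line ((rnorm x + 1) / rnorm v) v.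
apply: (K2 x); apply: (compact_closed (@norm_hausdorff _ _) Kc).
apply/closure_rnormP => e e0.
have [|_ [k ->] xk] := h (Num.min e 1); first by rewrite lt_min e0 ltr01.
exists (k *: v); last by apply: lt_le_trans xk _; rewrite ge_min lexx.
apply: K1; rewrite ler_pdivlMr ?rnorm_gt0// -rnormZ.
rewrite -[X in rnorm X](subrK x) addrC (le_trans (rnormD _ _))// lerD2l.
by rewrite rnormB (le_trans (ltW xk))// ge_min lexx orbT.
Qed.

End ClosedLines.

(** * Closed linear subspaces *)

Section ClosedSpan.
Variables (R : realType) (V : normedModType R[i]).
Implicit Types (S W : set V).

(** Taking the intersection of all closed subspaces, rather than the closure of
    the finite combinations, makes membership its own induction principle. *)
Definition cspan S : set V :=
  [set x | forall W, lin_subspace W -> closed W -> S `<=` W -> W x].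

Lemma sub_cspan S : S `<=` cspan S.
Proof. by move=> x Sx W _ _; exact. Qed.

Lemma cspan_ind S W : lin_subspace W -> closed W -> S `<=` W -> cspan S `<=` W.
Proof. by move=> lW cW SW x; exact. Qed.

Lemma cspan_lin S : lin_subspace (cspan S).
Proof.
split=> [W [W0 _] //|k x y Sx Sy W lW cW SW].
by apply: lW.2; [exact: Sx|exact: Sy].
Qed.

Lemma cspan_closed S : closed (cspan S).
Proof.
apply/closed_rnormP => x h W lW cW SW; move/closed_rnormP : (cW); apply => e e0.
by have [y Sy xy] := h e e0; exists y => //; exact: Sy.
Qed.

Lemma subspace0 W : lin_subspace W -> W 0. Proof. by case. Qed.

Lemma subspaceZ W k x : lin_subspace W -> W x -> W (k *: x).
Proof. by move=> [W0 lW] Wx; rewrite -[_ *: _]addr0; exact: lW. Qed.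

Lemma subspaceD W x y : lin_subspace W -> W x -> W y -> W (x + y).
Proof. by move=> [W0 lW] Wx Wy; rewrite -[x]scale1r; exact: lW. Qed.

End ClosedSpan.

Lemma closed_preimage (R : realType) (V W : normedModType R[i]) (f : V -> W)
  (S : set W) : continuous f -> closed S -> closed [set x | S (f x)].
Proof. by move=> fc; apply: (@closed_comp _ _ f) => x _; exact: fc. Qed.

Lemma linear_preimage (R : realType) (V W : normedModType R[i]) (f : V -> W)
  (S : set W) : (forall (k : R[i]) x y, f (k *: x + y) = k *: f x + f y) ->
  lin_subspace S -> lin_subspace [set x | S (f x)].
Proof.
move=> fl [S0 lS]; split => [|k x y Sx Sy] /=; last by rewrite fl; exact: lS.
suff -> : f 0 = 0 by [].
have := fl 1 0 0; rewrite scaler0 scale1r addr0 => /eqP.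
by rewrite -subr_eq subrr => /eqP <-.
Qed.

Lemma lin_subspace_line (R : realType) (V : normedModType R[i]) (v : V) :
  lin_subspace [set x | exists k : R[i], x = k *: v].
Proof.
split=> [|k _ _ [a ->] [b ->]]; first by exists 0; rewrite scale0r.
by exists (k * a + b); rewrite scalerDl scalerA.
Qed.

(** * Elementary estimates in C*-algebras and their representations *)

Section CStarBasics.
Variables (R : realType) (A : cstarAlgType R).
Implicit Types (a b x y : A) (k : R[i]).

Lemma cmul0l x : cmul 0 x = 0.
Proof. by rewrite -(scale0r (0 : A)) cmulZl !scale0r. Qed.

Lemma cmul0r x : cmul x 0 = 0.
Proof. by rewrite -(scale0r (0 : A)) cmulZr !scale0r. Qed.

Lemma cmulNl x y : cmul (- x) y = - cmul x y.
Proof. by rewrite -scaleN1r cmulZl scaleN1r. Qed.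

Lemma cmulNr x y : cmul x (- y) = - cmul x y.
Proof. by rewrite -scaleN1r cmulZr scaleN1r. Qed.

Lemma cmulBl x y z : cmul (x - y) z = cmul x z - cmul y z.
Proof. by rewrite cmulDl cmulNl. Qed.

Lemma cmulBr x y z : cmul x (y - z) = cmul x y - cmul x z.
Proof. by rewrite cmulDr cmulNr. Qed.

Lemma adj0 : adj (0 : A) = 0.
Proof. by have := Defs.adjZ (0 : R[i]) (0 : A); rewrite rmorph0 !scale0r. Qed.

Lemma adjN x : adj (- x) = - adj x.
Proof. by rewrite -scaleN1r Defs.adjZ rmorphN1 scaleN1r. Qed.

Lemma adjB x y : adj (x - y) = adj x - adj y.
Proof. by rewrite adjD adjN. Qed.

Lemma rnormM x y : rnorm (cmul x y) <= rnorm x * rnorm y.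
Proof. by have := cnormM x y; rewrite !rnormE -rmorphM/= lecR. Qed.

Lemma rnorm_adjM x : rnorm (cmul (adj x) x) = rnorm x ^+ 2.
Proof. by apply: complexI; rewrite rmorphXn/= -!rnormE cnorm_adjM. Qed.

Lemma rnorm_adj x : rnorm (adj x) = rnorm x.
Proof.
suff le y : rnorm y <= rnorm (adj y).
  by apply/le_anti; rewrite (le x) andbT -{2}(adjK x) le.
have [->|y0] := eqVneq y 0; first by rewrite adj0.
by rewrite -(@ler_pM2r _ (rnorm y)) ?rnorm_gt0// -expr2 -rnorm_adjM rnormM.
Qed.

Lemma cmull_continuous a : continuous (cmul a).
Proof.
apply: (@rnorm_lipschitz_continuous _ _ _ _ (rnorm a)) => x y.
by rewrite -cmulBr rnormM.
Qed.

Lemma cmulr_continuous a : continuous (cmul^~ a).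
Proof.
apply: (@rnorm_lipschitz_continuous _ _ _ _ (rnorm a)) => x y.
by rewrite -cmulBl mulrC rnormM.
Qed.

Lemma adj_continuous : continuous (@adj R A).
Proof.
apply: (@rnorm_lipschitz_continuous _ _ _ _ 1) => x y.
by rewrite -adjB rnorm_adj mul1r.
Qed.

Lemma cmull_linear a k x y : cmul a (k *: x + y) = k *: cmul a x + cmul a y.
Proof. by rewrite cmulDr cmulZr. Qed.

Lemma cmulr_linear a k x y : cmul (k *: x + y) a = k *: cmul x a + cmul y a.
Proof. by rewrite cmulDl cmulZl. Qed.

Lemma adj_preimage_lin (S : set A) :
  lin_subspace S -> lin_subspace [set x | S (adj x)].
Proof.
move=> lS; split=> [|k x y Sx Sy] /=; first by rewrite adj0; exact: subspace0.
by rewrite adjD Defs.adjZ; apply: subspaceD => //; exact: subspaceZ.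
Qed.

End CStarBasics.

Section HilbertBasics.
Variables (R : realType) (H : hilbertType R).
Implicit Types (u v w : H) (k : R[i]).

Lemma hdotDl u v w : hdot (u + v) w = hdot u w + hdot v w.
Proof. exact: linearDl. Qed.

Lemma hdotDr u v w : hdot w (u + v) = hdot w u + hdot w v.
Proof. exact: linearDr. Qed.

Lemma hdotZl k u w : hdot (k *: u) w = k * hdot u w.
Proof. exact: linearZl_LR. Qed.

Lemma hdotZr k u w : hdot w (k *: u) = Num.conj k * hdot w u.
Proof. exact: linearZr_LR. Qed.

Lemma hdotC u v : hdot u v = Num.conj (hdot v u).
Proof. by rewrite hermC expr0 mul1r. Qed.

Lemma hdotNl u w : hdot (- u) w = - hdot u w.
Proof. by rewrite -scaleN1r hdotZl mulN1r. Qed.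

Lemma hdotNr u w : hdot w (- u) = - hdot w u.
Proof. by rewrite -scaleN1r hdotZr rmorphN1 mulN1r. Qed.

Lemma hdotBl u v w : hdot (u - v) w = hdot u w - hdot v w.
Proof. by rewrite hdotDl hdotNl. Qed.

Lemma hdotBr u v w : hdot w (u - v) = hdot w u - hdot w v.
Proof. by rewrite hdotDr hdotNr. Qed.

Lemma hdot0l w : hdot (0 : H) w = 0.
Proof. by rewrite -(scale0r (0 : H)) hdotZl mul0r. Qed.

Lemma hdot0r w : hdot w (0 : H) = 0.
Proof. by rewrite -(scale0r (0 : H)) hdotZr rmorph0 mul0r. Qed.

Lemma hdot_rnorm u : hdot u u = (rnorm u ^+ 2)%:C%C.
Proof. by rewrite -hdot_norm rnormE rmorphXn. Qed.

Lemma hdot_inj u v : (forall w, hdot u w = hdot v w) -> u = v.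
Proof.
move=> uv; apply/eqP; rewrite -subr_eq0 -rnorm_eq0 -sqrf_eq0.
by apply/eqP/complexI; rewrite -hdot_rnorm hdotBl uv subrr.
Qed.

End HilbertBasics.

Lemma dot_CauchySchwarz (R : realType) (U : lmodType R[i])
    (f : {dot U for (@Num.conj R[i])}) (u v : U) :
  cmod (f u v) ^+ 2 <= complex.Re (f u u) * complex.Re (f v v).
Proof.
have ff w : f w w = (complex.Re (f w w))%:C%C.
  by rewrite RRe_real// ger0_real// dnorm_ge0.
have [->|v0] := eqVneq v 0; first by rewrite !linear0r cmod0 expr0n /= ?mulr0 lexx.
have vv0 : 0 < complex.Re (f v v) by rewrite -ltcR -ff dnorm_gt0.
set a := complex.Re (f v v); set c := f u v.
have := dnorm_ge0 f (a%:C%C *: u - c *: v).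
have -> : f (a%:C%C *: u - c *: v) (a%:C%C *: u - c *: v) =
    a%:C%C * (a%:C%C * (complex.Re (f u u))%:C%C - c * Num.conj c).
  have vu : f v u = Num.conj c by rewrite hermC expr0 mul1r.
  have ca : Num.conj a%:C%C = a%:C%C :> R[i] by exact: conjc_real.
  have vv : f v v = a%:C%C by rewrite ff.
  rewrite linearBl !linearBr/= !linearZl_LR/= !linearZr_LR/= vu -/c vv ca -(ff u).
  by rewrite /GRing.scale/=; ring.
rewrite mul_conj_cmod -rmorphM -rmorphB -rmorphM ler0c pmulr_rge0//.
by rewrite subr_ge0 mulrC.
Qed.

Lemma hdot_CauchySchwarz (R : realType) (H : hilbertType R) (u v : H) :
  cmod (hdot u v) <= rnorm u * rnorm v.
Proof.
rewrite -ler_sqr ?nnegrE ?cmod_ge0 ?mulr_ge0 ?rnorm_ge0//.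
apply: le_trans (dot_CauchySchwarz _ u v) _.
by rewrite !hdot_rnorm/= exprMn.
Qed.

Section Representations.
Variables (R : realType) (A : cstarAlgType R) (H : hilbertType R).
Variable p : representation A H.

Lemma repDl a b u : p (a + b) u = p a u + p b u.
Proof. by have := repD p 1 a b u; rewrite !scale1r. Qed.

Lemma rep0l u : p 0 u = 0.
Proof.
have := repDl 0 0 u; rewrite addr0 => /eqP.
by rewrite -subr_eq subrr => /eqP <-.
Qed.

Lemma repZl k a u : p (k *: a) u = k *: p a u.
Proof. by have := repD p k a 0 u; rewrite addr0 rep0l addr0. Qed.

Lemma repBl a b u : p (a - b) u = p a u - p b u.
Proof. by rewrite repDl -scaleN1r repZl scaleN1r. Qed.

Lemma rep0r a : p a 0 = 0.
Proof.
have := rep_linear p a 1 0 0; rewrite !scale1r addr0 => /eqP.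
by rewrite -subr_eq subrr => /eqP <-.
Qed.

Lemma repDr a u v : p a (u + v) = p a u + p a v.
Proof. by have := rep_linear p a 1 u v; rewrite !scale1r. Qed.

Lemma repZr a k u : p a (k *: u) = k *: p a u.
Proof. by have := rep_linear p a k u 0; rewrite !addr0 rep0r addr0. Qed.

End Representations.

(** * Representations are bounded *)

Section GeometricCauchy.
Variables (R : realType) (V : completeNormedModType R[i]).

Lemma half_expr_small (e : R) : 0 < e -> exists n, (2^-1 : R) ^+ n < e.
Proof.
move=> e0; have h1 : `|2^-1 : R| < 1 by rewrite ger0_norm ?invr_ge0// invf_lt1// ltr1n.
have /cvgrPdist_lt/(_ _ e0)[N _ /(_ N)] := cvg_expr h1.
rewrite sub0r normrN normrX ger0_norm ?invr_ge0// => h.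
by exists N; apply: h => /=.
Qed.

Lemma geometric_cauchy_cvg (x : nat -> V) :
  (forall n, rnorm (x n.+1 - x n) <= 2^-1 ^+ n.+1) ->
  exists l, forall e : R, 0 < e -> exists N, forall n, (N <= n)%N -> rnorm (l - x n) < e.
Proof.
move=> xS.
have xm n m : rnorm (x (n + m)%N - x n) <= 2^-1 ^+ n - 2^-1 ^+ (n + m).
  elim: m => [|m IH]; first by rewrite addn0 !subrr rnorm0.
  rewrite addnS; apply: le_trans (rnorm_tri (x (n + m)%N) _ _) _.
  apply: le_trans (lerD (xS _) IH) _.
  by rewrite exprS le_eqVlt; apply/orP; left; apply/eqP; field.
have : cauchy (x @ \oo).
  apply/cauchy_rnormP => e e0; have [n ne] := half_expr_small e0.
  exists (x n); exists n => // m /= nm; rewrite -(subnKC nm) rnormB.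
  apply: le_lt_trans (xm _ _) _; apply: le_lt_trans ne.
  by rewrite gerBl exprn_ge0.
move=> /cauchy_cvg/cvg_ex[l /cvg_rnormP xl]; exists l => e /xl[N _ h].
by exists N => n nN; exact: h.
Qed.

End GeometricCauchy.

(** If $\|k\|\le 3/4$, the self-adjoint iterates of the contraction
    $b\mapsto (k+b^2)/2$ of the ball of radius one half converge to a
    self-adjoint solution of $(1-b)^2=1-k$, written without a unit. The ball is
    preserved because $(3/4+1/4)/2=1/2$. *)
Lemma sqrt_one_minus (R : realType) (A : cstarAlgType R) (k : A) :
  adj k = k -> rnorm k <= 3%:R / 4%:R ->
  exists2 b : A, adj b = b & b + b = k + cmul b b.
Proof.
move=> ka kn.
pose c : R[i] := (2^-1 : R)%:C%C.
have cE : cmod c = 2^-1 by rewrite cmod_real ger0_norm// invr_ge0.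
have cR : Num.conj c = c by exact: conjc_real.
pose f b : A := c *: (k + cmul b b).
pose x n := iter n f 0.
have xE n : x n.+1 = f (x n) by [].
have x2 n : rnorm (x n) <= 2^-1.
  elim: n => [|n IH]; first by rewrite [x 0%N]/(0 : A) rnorm0 invr_ge0.
  rewrite xE /f rnormZ cE.
  have h1 := rnormD k (cmul (x n) (x n)).
  have h2 := rnormM (x n) (x n).
  have h3 := rnorm_ge0 (x n).
  have h4 : rnorm (x n) * rnorm (x n) <= 2^-1 * 2^-1 by exact: ler_pM.
  lra.
have fL a b : rnorm a <= 2^-1 -> rnorm b <= 2^-1 ->
    rnorm (f a - f b) <= 2^-1 * rnorm (a - b).
  move=> a2 b2; rewrite /f -scalerBr rnormZ cE ler_pM2l ?invr_gt0//.
  have -> : k + cmul a a - (k + cmul b b) = cmul a (a - b) + cmul (a - b) b.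
    rewrite cmulBr cmulBl opprD addrACA subrr add0r.
    by rewrite addrA subrK.
  apply: le_trans (rnormD _ _) _.
  have h1 := rnormM a (a - b); have h2 := rnormM (a - b) b.
  have h3 : rnorm a * rnorm (a - b) <= 2^-1 * rnorm (a - b).
    by rewrite ler_wpM2r ?rnorm_ge0.
  have h4 : rnorm (a - b) * rnorm b <= rnorm (a - b) * 2^-1.
    by rewrite ler_wpM2l ?rnorm_ge0.
  lra.
have xS n : rnorm (x n.+1 - x n) <= 2^-1 ^+ n.+1.
  elim: n => [|n IH]; first by rewrite [x 0%N]/(0 : A) subr0 expr1; exact: x2.
  rewrite [x n.+2]xE [X in _ - X]xE.
  apply: le_trans (fL _ _ (x2 _) (x2 _)) _.
  by rewrite [leRHS]exprS ler_pM2l ?invr_gt0.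
have [b xb] := geometric_cauchy_cvg xS.
have b2 : rnorm b <= 2^-1.
  apply/ler_addgt0Pl => e /xb[N /(_ _ (leqnn N)) h].
  rewrite -[X in rnorm X](subrK (x N)).
  by apply: le_trans (rnormD _ _) _; rewrite lerD// ltW.
have bf : b = f b.
  apply/eqP; rewrite -subr_eq0 -rnorm_eq0 eq_le rnorm_ge0 andbT.
  apply/ler_addgt0Pl => e e0; rewrite addr0.
  have [|N h] := xb (e / 2%:R); first by rewrite divr_gt0.
  apply: le_trans (rnorm_tri (x N.+1) _ _) _.
  have h1 := h N.+1 (leqnSn _); have h2 := fL _ _ (x2 N) b2.
  have h3 := h N (leqnn _); rewrite rnormB in h3.
  have := rnorm_ge0 (x N - b).
  rewrite -xE in h2.
  lra.
exists b; last first.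
  rewrite {1 2}bf /f -scalerDl -rmorphD/= -[RHS]scale1r; congr (_ *: _).
  by rewrite -[RHS](rmorph1 (real_complex R)) /c; congr (_%:C%C); field.
have xa n : adj (x n) = x n.
  elim: n => [|n IH]; first by rewrite [x 0%N]/(0 : A) adj0.
  by rewrite xE /f Defs.adjZ adjD adjM IH ka cR.
apply/eqP; rewrite -subr_eq0 -rnorm_eq0 eq_le rnorm_ge0 andbT.
apply/ler_addgt0Pl => e e0; rewrite addr0.
have [|N /(_ N (leqnn _)) h] := xb (e / 2%:R); first by rewrite divr_gt0.
apply: le_trans (rnorm_tri (x N) _ _) _.
have : rnorm (adj b - x N) = rnorm (b - x N).
  by rewrite -[in LHS](xa N) -adjB rnorm_adj.
move: h; rewrite (rnormB (x N)); lra.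
Qed.

Section RepBound.
Variables (R : realType) (A : cstarAlgType R) (H : hilbertType R).
Variable p : representation A H.

(** With $k=a^*a$ and $(1-b)^2=1-k$ one has
    $\|u\|^2-\|\pi(a)u\|^2=\|u-\pi(b)u\|^2\ge 0$. *)
Lemma rep_contractive_small a u :
  rnorm (cmul (adj a) a) <= 3%:R / 4%:R -> rnorm (p a u) <= rnorm u.
Proof.
move=> a34.
have [|b ba bE] := sqrt_one_minus _ a34; first by rewrite adjM adjK.
rewrite -ler_sqr ?nnegrE ?rnorm_ge0// -lecR -!hdot_rnorm -subr_ge0.
suff -> : hdot u u - hdot (p a u) (p a u) = hdot (u - p b u) (u - p b u).
  by rewrite hdot_rnorm ler0c sqr_ge0.
rewrite rep_adj -repM.
have -> : cmul (adj a) a = b + b - cmul b b by rewrite bE addrK.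
rewrite repBl repDl hdotBr hdotDr !hdotBr !hdotBl repM.
have e1 : hdot (p b u) u = hdot u (p b u) by rewrite rep_adj ba.
have e2 : hdot (p b u) (p b u) = hdot u (p b (p b u)) by rewrite rep_adj ba.
rewrite e1 e2; ring.
Qed.

(** Rescaling $a$ to norm one half meets the smallness condition, whence the
    factor $2$; representations are in fact contractive, but any bound will do. *)
Lemma rep_bounded a u : rnorm (p a u) <= 2 * rnorm a * rnorm u.
Proof.
have [->|a0] := eqVneq a 0.
  by rewrite rep0l !rnorm0 mulr0 mul0r lexx.
have n0 : 0 < rnorm a by rewrite rnorm_gt0.
pose t : R := (2 * rnorm a)^-1.
have t0 : 0 < t by rewrite invr_gt0 mulr_gt0.
have tE : cmod t%:C%C = t by rewrite cmod_real gtr0_norm.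
have : rnorm (p (t%:C%C *: a) u) <= rnorm u.
  apply: rep_contractive_small; rewrite rnorm_adjM rnormZ tE.
  have -> : t * rnorm a = 2^-1 by rewrite /t; field; rewrite gt_eqF.
  lra.
by rewrite repZl rnormZ tE /t mulrC ler_pdivrMr ?mulr_gt0// mulrC.
Qed.

End RepBound.

(** * Compact operators *)

Section Precompact.
Variables (R : realType) (V : completeNormedModType R[i]).

Lemma precompact_sub (S K : set V) : compact K -> S `<=` K -> precompact S.
Proof.
move=> Kc SK; apply: precompact_subset SK _.
exact: compact_precompact (@norm_hausdorff _ _) Kc.
Qed.

(** An ultrafilter on the closure of the set contains a ball of each radius:
    otherwise, by compactness, it would contain the complement of a neighborhood
    of some approximating compact set. Hence it is Cauchy. *)
Lemma precompact_approx (S : set V) :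
  (forall e : R, 0 < e -> exists2 K : set V, compact K &
     forall x, S x -> exists2 k, K k & rnorm (x - k) < e) ->
  precompact S.
Proof.
move=> approx; rewrite precompactE compact_ultra => F UF FS.
have : cauchy F.
  apply/cauchy_rnormP => e e0.
  have e2 : 0 < e / 2 by rewrite divr_gt0.
  have e4 : 0 < e / 4%:R by rewrite divr_gt0.
  have [K Kc SK] := approx _ e4.
  apply: contrapT => noball.
  have far k : K k -> \forall x' \near k & y \near F, ~ rnorm (y - x') < e / 2.
    move=> _.
    have Fc : F (~` [set y | rnorm (k - y) < e]).
      have [Fb|//] := in_ultra_setVsetC [set y | rnorm (k - y) < e] UF.
      by case: noball; exists k.
    exists ([set x' | rnorm (k - x') < e / 2], ~` [set y | rnorm (k - y) < e]).
      by split => //=; apply/nbhs_rnormP; exists (e / 2).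
    move=> [x' y] /= [kx ky] yx; apply: ky.
    apply: le_lt_trans (rnorm_tri x' _ _) _; rewrite (rnormB x' y) in yx *.
    lra.
  have /= FK := (compact_near_coveringP K).1 Kc _ F (fun y z => ~ rnorm (y - z) < e / 2) _ far.
  have FKS : F ((fun y => K `<=` (fun z => ~ rnorm (y - z) < e / 2)) `&` closure S).
    by apply: filterI FS; exact: FK.
  have [y [Fy cy]] := filter_ex FKS.
  have [z Sz yz] := (closure_rnormP _ _).1 cy _ e4.
  have [k Kk zk] := SK _ Sz.
  apply: (Fy k Kk); apply: le_lt_trans (rnorm_tri z _ _) _; lra.
move=> /cauchy_cvg/cvg_ex[l Fl]; exists l; split => //.
by apply: (closed_cvg (u_ := id) _ (@closed_closure _ S)) Fl.
Qed.

End Precompact.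

Section CompactOperators.
Variables (R : realType) (H : hilbertType R).
Implicit Types f g : H -> H.

Lemma in_unit_ball (u : H) : (`|u| <= 1) = (rnorm u <= 1).
Proof. by rewrite -(rmorph1 (real_complex R)) rnorm_le. Qed.

Lemma compact_operator_lin (k : R[i]) f g :
  compact_operator f -> compact_operator g ->
  compact_operator (fun u => k *: f u + g u).
Proof.
rewrite /compact_operator !precompactE => fc gc.
pose h (q : H * H) := k *: q.1 + q.2.
have hc : continuous h.
  move=> q; apply: cvgD; last exact: cvg_snd.
  by apply: cvgZr; exact: cvg_fst.
rewrite -precompactE; apply: (@precompact_sub _ _ _ (h @` (_ `*` _))).
  by apply: continuous_compact (compact_setX fc gc); exact: continuous_subspaceT.
move=> _ [u u1 <-]; exists (f u, g u) => //.
by split; apply: subset_closure; exists u.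
Qed.

Lemma compact_operator_limit f :
  (forall e : R, 0 < e -> exists2 g, compact_operator g &
     forall u, rnorm u <= 1 -> rnorm (f u - g u) < e) ->
  compact_operator f.
Proof.
move=> fg; apply: precompact_approx => e /fg[g gc fge].
rewrite /compact_operator precompactE in gc; exists (closure (g @` [set u | `|u| <= 1])) => //.
move=> _ [u u1 <-]; exists (g u); first by apply: subset_closure; exists u.
by apply: fge; rewrite -in_unit_ball.
Qed.

Lemma rank_one_compact f (v : H) (M : R) :
  (forall u, exists k : R[i], f u = k *: v) ->
  (forall u, rnorm (f u) <= M * rnorm u) -> compact_operator f.
Proof.
move=> fv fM; have [K Kc [K1 _]] := compact_disc_line (`|M| / rnorm v) v.
apply: (precompact_sub Kc) => _ [u u1 <-].
have [k fk] := fv u; have := fM u; rewrite fk.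
have [->|v0] := eqVneq v 0.
  move=> _; have := K1 0; rewrite scaler0 scale0r cmod0; apply.
  by rewrite divr_ge0// rnorm_ge0.
move=> kM; apply: K1; rewrite ler_pdivlMr ?rnorm_gt0// -rnormZ.
move: u1; rewrite /= in_unit_ball => u1.
apply: le_trans kM _; apply: (@le_trans _ _ (`|M| * rnorm u)).
  by rewrite ler_wpM2r ?rnorm_ge0 ?ler_norm.
by rewrite ler_piMr.
Qed.

End CompactOperators.

(** * A criterion for liminality *)

Section Liminality.
Variables (R : realType) (A : cstarAlgType R).

(** In an operator algebra these are the elements $e$ whose corner
    $e A e$ is at most one-dimensional, e.g. rank-one operators. *)
Definition corner (e : A) : Prop :=
  forall x : A, exists k : R[i], cmul (cmul e x) e = k *: e.

Variables (H : hilbertType R) (p : representation A H).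
Hypothesis irr : irreducible p.

(** If $\pi(e)u\neq 0$, then $\pi(A)\pi(e)u$ is dense and
    $\pi(e)\pi(A)\pi(e)u$ consists of multiples of $\pi(e)u$. *)
Lemma corner_rank_one e : corner e ->
  exists v, forall u, exists k : R[i], p e u = k *: v.
Proof.
move=> ce; have [[u0 eu0]|] := pselect (exists u0, p e u0 != 0); last first.
  move=> n; exists 0 => u; exists 0; rewrite scaler0; apply/eqP/negP => u0.
  by apply: n; exists u; apply/negP.
pose v := p e u0; exists v.
have [[u1 u1n] irrS] := irr.
have N0 w : (forall x, p x w = 0) -> w = 0.
  move=> xw; pose N := [set w | forall x, p x w = 0].
  have lN : lin_subspace N.
    split=> [x|k y z Ny Nz x]; first by rewrite rep0r.
    by rewrite rep_linear Ny Nz scaler0 addr0.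
  have cN : closed N.
    apply/closed_rnormP => y h x; apply/eqP; rewrite -rnorm_eq0 eq_le rnorm_ge0 andbT.
    apply/ler_addgt0Pl => r r0; rewrite addr0.
    have s0 : 0 < r / (2 * rnorm x + 1).
      by rewrite divr_gt0// ltr_wpDl ?mulr_ge0 ?rnorm_ge0.
    have [z Nz yz] := h _ s0.
    have -> : p x y = p x (y - z).
      by rewrite repDr -scaleN1r repZr Nz scaler0 addr0.
    apply: le_trans (rep_bounded _ _ _) _.
    move: yz; rewrite ltr_pdivlMr ?ltr_wpDl ?mulr_ge0 ?rnorm_ge0// => yz.
    by apply: ltW; apply: le_lt_trans yz; rewrite mulrC ler_wpM2l ?rnorm_ge0// lerDl.
  have [|NE|NT] := irrS N lN cN.
  - by move=> a u Nu x; rewrite -repM Nu.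
  - by have : N w by []; rewrite NE.
  have Nu0 : N u0 by rewrite NT.
  by move/eqP : eu0; case; exact: Nu0.
pose S := cspan [set y | exists x, y = p x v].
have ST : S = setT.
  have [|S0|//] := irrS S (@cspan_lin _ _ _) (@cspan_closed _ _ _).
    move=> a; apply: cspan_ind.
    - by apply: linear_preimage; [exact: rep_linear|exact: cspan_lin].
    - by apply: closed_preimage; [exact: rep_continuous|exact: cspan_closed].
    - move=> _ [x ->]; apply: sub_cspan; exists (cmul a x); by rewrite repM.
  exfalso; move/eqP : eu0; apply; apply: N0 => x.
  have : S (p x v) by apply: sub_cspan; exists x.
  by rewrite S0.
move=> u; have : S u by rewrite ST.
move: u; apply: cspan_ind.
- by apply: linear_preimage (lin_subspace_line v); exact: rep_linear.
- by apply: closed_preimage (closed_line (v := v)); exact: rep_continuous.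
- move=> _ [x ->] /=; have [k ek] := ce x; exists k.
  by rewrite -repZl -ek !repM.
Qed.

Lemma cspan_corner_compact : cspan corner `<=` [set a | compact_operator (p a)].
Proof.
apply: cspan_ind.
- split=> [|k x y cx cy].
    apply: (@rank_one_compact _ _ _ 0 0) => u.
      by exists 0; rewrite rep0l scaler0.
    by rewrite rep0l rnorm0 mul0r lexx.
  rewrite /= (_ : p _ = fun u => k *: p x u + p y u); first exact: compact_operator_lin.
  by apply/funext => u; rewrite repD.
- apply/closed_rnormP => a h; apply: compact_operator_limit => e e0.
  have [|b cb ab] := h (e / 2%:R); first by rewrite divr_gt0.
  exists (p b) => // u u1; rewrite -repBl.
  apply: le_lt_trans (rep_bounded _ _ _) _.
  apply: (@le_lt_trans _ _ (2 * rnorm (a - b))); last by lra.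
  by rewrite ler_piMr// mulr_ge0// rnorm_ge0.
- move=> e ce; have [v ev] := corner_rank_one ce.
  exact: (@rank_one_compact _ _ _ v (2 * rnorm e)) (rep_bounded p e).
Qed.

End Liminality.

(** Corner elements act with rank at most one in every irreducible representation,
    and representations are bounded, so limits of their combinations act compactly. *)
Lemma liminal_of_corners (R : realType) (A : cstarAlgType R) :
  cspan (@corner R A) = setT -> liminal A.
Proof.
by move=> AT H p irr a; apply: (cspan_corner_compact irr); rewrite AT.
Qed.

(** * Bounded families of operators on a Hilbert space *)

(** The index set is built into the algebra so that the supremum norm over all
    components needs no separate construction of products of C*-algebras; a
    one-point index set gives all bounded operators on $H$. *)

Section OperatorFamilies.
Variables (R : realType) (I : Type) (H : hilbertType R).

Definition adjoint_families (a b : I -> H -> H) : Prop :=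
  forall i u v, hdot (a i u) v = hdot u (b i v).

Definition bounded_family (a : I -> H -> H) (M : R) : Prop :=
  forall i u, rnorm (a i u) <= M * rnorm u.

(** Having an adjoint forces each component to be linear. *)
Definition opfam_set : set (I -> H -> H) :=
  [set a | (exists M, bounded_family a M) /\ exists b, adjoint_families a b].

Definition opfam : Type := {a : I -> H -> H | a \in opfam_set}.

HB.instance Definition _ := [isSub of opfam for @sval (I -> H -> H) _].
HB.instance Definition _ := [Choice of opfam by <:].

Lemma opfam_set_lin (k : R[i]) a b :
  opfam_set a -> opfam_set b -> opfam_set (fun i u => k *: a i u + b i u).
Proof.
move=> [[M aM] [a' aa']] [[N bN] [b' bb']]; split.
  exists (cmod k * M + N) => i u.
  apply: le_trans (rnormD _ _) _; rewrite rnormZ mulrDl lerD// -mulrA.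
  by rewrite ler_wpM2l ?cmod_ge0.
exists (fun i v => Num.conj k *: a' i v + b' i v) => i u v.
by rewrite hdotDl hdotZl hdotDr hdotZr conjCK aa' bb'.
Qed.

Lemma opfam_set0 : opfam_set (fun _ _ => 0).
Proof.
split; first by exists 0 => i u; rewrite rnorm0 mul0r.
by exists (fun _ _ => 0) => i u v; rewrite hdot0l hdot0r.
Qed.

Lemma opfam_submod : subsemimod_closed (mem opfam_set).
Proof.
split; first split.
- exact/mem_set/opfam_set0.
- move=> x y /set_mem Jx /set_mem Jy; apply/mem_set.
  have := opfam_set_lin 1 Jx Jy; congr opfam_set.
  by apply/funext => i; apply/funext => u; rewrite scale1r.
- move=> k x /set_mem Jx; apply/mem_set.
  have := opfam_set_lin k Jx opfam_set0; congr opfam_set.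
  by apply/funext => i; apply/funext => u; rewrite addr0.
Qed.

HB.instance Definition _ :=
  GRing.SubChoice_isSubLmodule.Build R[i] (I -> H -> H) (mem opfam_set) opfam
    opfam_submod.

Implicit Types a b : opfam.

Definition opf (a : opfam) : I -> H -> H := sval a.

Lemma opfam_ext a b : (forall i u, opf a i u = opf b i u) -> a = b.
Proof.
by move=> ab; apply: val_inj; apply/funext => i; apply/funext => u; exact: ab.
Qed.

Lemma opfamD a b i u : opf (a + b) i u = opf a i u + opf b i u.
Proof. by []. Qed.

Lemma opfamZ (k : R[i]) a i u : opf (k *: a) i u = k *: opf a i u.
Proof. by []. Qed.

Lemma opfamN a i u : opf (- a) i u = - opf a i u.
Proof. by []. Qed.

Lemma opfam0 i u : opf 0 i u = 0.
Proof. by []. Qed.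

Lemma opfamP a : opfam_set (opf a).
Proof. exact/set_mem/(valP a). Qed.

Definition opfam_adj_fun (a : opfam) : I -> H -> H := sval (cid (opfamP a).2).

Lemma opfam_adj_funP a : adjoint_families (opf a) (opfam_adj_fun a).
Proof. exact: (svalP (cid (opfamP a).2)). Qed.

Definition opfam_norm a : R :=
  inf [set M | 0 <= M /\ bounded_family (opf a) M].

Lemma opfam_norm_has_inf a : has_inf [set M | 0 <= M /\ bounded_family (opf a) M].
Proof.
split; last by exists 0 => M [].
have [[M aM] _] := opfamP a; exists `|M|; split => // i u.
by apply: le_trans (aM i u) _; rewrite ler_wpM2r ?rnorm_ge0 ?ler_norm.
Qed.

Lemma opfam_norm_le a M : 0 <= M -> bounded_family (opf a) M -> opfam_norm a <= M.
Proof. by move=> M0 aM; apply: ge_inf => //; exact: (opfam_norm_has_inf a).2. Qed.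

Lemma opfam_norm_ge0 a : 0 <= opfam_norm a.
Proof. by apply: lb_le_inf => [|M []//]; exact: (opfam_norm_has_inf a).1. Qed.

Lemma opfam_normP a : bounded_family (opf a) (opfam_norm a).
Proof.
move=> i u; have [->|u0] := eqVneq u 0.
  have [M aM] := (opfamP a).1; have := aM i 0.
  by rewrite rnorm0 !mulr0.
rewrite -ler_pdivrMr ?rnorm_gt0//; apply: lb_le_inf => [|M [_ aM]].
  exact: (opfam_norm_has_inf a).1.
by rewrite ler_pdivrMr ?rnorm_gt0.
Qed.

Let cnorm a : R[i] := (opfam_norm a)%:C%C.

Let cnormD a b : cnorm (a + b) <= cnorm a + cnorm b.
Proof.
rewrite /cnorm -rmorphD/= lecR; apply: opfam_norm_le => [|i u].
  by rewrite addr_ge0// opfam_norm_ge0.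
rewrite opfamD (le_trans (rnormD _ _))// mulrDl.
by rewrite lerD// opfam_normP.
Qed.

Let cnormZ_le (k : R[i]) a : opfam_norm (k *: a) <= cmod k * opfam_norm a.
Proof.
apply: opfam_norm_le => [|i u]; first by rewrite mulr_ge0 ?cmod_ge0 ?opfam_norm_ge0.
by rewrite opfamZ rnormZ -mulrA ler_wpM2l ?cmod_ge0 ?opfam_normP.
Qed.

Let cnormZ (k : R[i]) a : cnorm (k *: a) = `|k| * cnorm a.
Proof.
rewrite /cnorm cmodE -rmorphM/=; congr (_%:C%C); apply/le_anti.
rewrite cnormZ_le/=; have [->|k0] := eqVneq k 0.
  by rewrite cmod0 mul0r opfam_norm_ge0.
rewrite -ler_pdivlMl; last by rewrite lt_def cmod_ge0 cmod_eq0 k0.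
rewrite -cmodV; apply: le_trans (cnormZ_le _ _).
by rewrite scalerA mulVf// scale1r.
Qed.

Let cnorm0 a : cnorm a = 0 -> a = 0.
Proof.
move=> /complexI a0; apply: opfam_ext => i u; apply/eqP.
rewrite opfam0 -rnorm_eq0 eq_le rnorm_ge0 andbT.
by apply: le_trans (opfam_normP _ _ _) _; rewrite a0 mul0r.
Qed.

HB.instance Definition _ :=
  Lmodule_isNormed.Build R[i] opfam cnormD cnormZ cnorm0.

Lemma opfam_rnormP a : bounded_family (opf a) (rnorm a).
Proof. exact: opfam_normP. Qed.

Lemma opfam_rnorm_le a M : 0 <= M -> bounded_family (opf a) M -> rnorm a <= M.
Proof. exact: opfam_norm_le. Qed.

Lemma opfam_rnormB a b i u :
  rnorm (opf a i u - opf b i u) <= rnorm (a - b) * rnorm u.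
Proof. exact: (opfam_rnormP (a - b)). Qed.

(** The adjoint family satisfies the same bound, by the Cauchy-Schwarz
    inequality applied to $\|a^*v\|^2=\langle a a^*v,v\rangle$. *)
Lemma bounded_adjoint (f g : I -> H -> H) M : 0 <= M ->
  adjoint_families f g -> bounded_family f M -> bounded_family g M.
Proof.
move=> M0 fg fM i v; have [->|g0] := eqVneq (g i v) 0.
  by rewrite rnorm0 mulr_ge0 ?rnorm_ge0.
rewrite -(@ler_pM2l _ (rnorm (g i v))) ?rnorm_gt0// -expr2.
rewrite -(ger0_norm (sqr_ge0 _)) -cmod_real -hdot_rnorm -fg.
apply: le_trans (hdot_CauchySchwarz _ _) _.
by rewrite mulrCA mulrA ler_wpM2r ?rnorm_ge0.
Qed.

Lemma adjoint_families_sym (f g : I -> H -> H) :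
  adjoint_families f g -> adjoint_families g f.
Proof. by move=> fg i u v; rewrite hdotC -fg -hdotC. Qed.

Lemma opfam_adj_bounded a : bounded_family (opfam_adj_fun a) (rnorm a).
Proof.
exact: bounded_adjoint (rnorm_ge0 _) (opfam_adj_funP a) (opfam_rnormP a).
Qed.

Lemma opfam_adj_subproof a : opfam_adj_fun a \in opfam_set.
Proof.
apply/mem_set; split; first by exists (rnorm a); exact: opfam_adj_bounded.
by exists (opf a); exact/adjoint_families_sym/opfam_adj_funP.
Qed.

Definition opfam_adj a : opfam := exist _ (opfam_adj_fun a) (opfam_adj_subproof a).

Lemma opfam_adjP a i u v : hdot (opf a i u) v = hdot u (opf (opfam_adj a) i v).
Proof. exact: opfam_adj_funP. Qed.

Lemma opfam_adj_unique a b : adjoint_families (opf a) (opf b) -> opfam_adj a = b.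
Proof.
move=> ab; apply: opfam_ext => i u; apply: hdot_inj => w.
by rewrite [LHS]hdotC -opfam_adjP ab -hdotC.
Qed.

Lemma opfam_lin a i (k : R[i]) u v :
  opf a i (k *: u + v) = k *: opf a i u + opf a i v.
Proof.
apply: hdot_inj => w.
by rewrite opfam_adjP !hdotDl !hdotZl !opfam_adjP.
Qed.

Lemma opfam_mul_subproof a b : (fun i u => opf a i (opf b i u)) \in opfam_set.
Proof.
apply/mem_set; split.
  exists (rnorm a * rnorm b) => i u; apply: le_trans (opfam_rnormP _ _ _) _.
  by rewrite -mulrA ler_wpM2l ?rnorm_ge0 ?opfam_rnormP.
exists (fun i u => opf (opfam_adj b) i (opf (opfam_adj a) i u)) => i u v.
by rewrite !opfam_adjP.
Qed.

Definition opfam_mul a b : opfam :=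
  exist _ (fun i u => opf a i (opf b i u)) (opfam_mul_subproof a b).

Lemma opfam_mulE a b i u : opf (opfam_mul a b) i u = opf a i (opf b i u).
Proof. by []. Qed.

Lemma opfam_complete (F : set_system opfam) :
  ProperFilter F -> cauchy F -> cvg F.
Proof.
move=> FF /cauchy_rnormP Fc.
have pointwise (f : opfam -> I -> H -> H) :
    (forall a b i u, rnorm (f a i u - f b i u) <= rnorm (a - b) * rnorm u) ->
    forall i u, exists l, forall e : R, 0 < e ->
      \forall a \near F, rnorm (l - f a i u) < e.
  move=> fB i u; have : cauchy ((fun a => f a i u) @ F).
    apply/cauchy_rnormP => e e0; have u1 : 0 < rnorm u + 1.
      by rewrite ltr_wpDl ?rnorm_ge0.
    have [x xF] := Fc (e / (rnorm u + 1)) (divr_gt0 e0 u1).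
    exists (f x i u); rewrite /= near_map; apply: filterS xF => y xy.
    apply: le_lt_trans (fB _ _ _ _) _; move: xy; rewrite ltr_pdivlMr//.
    by apply: le_lt_trans; rewrite ler_wpM2l ?rnorm_ge0 ?lerDl.
  by move=> /cauchy_cvg/cvg_ex[l /cvg_rnormP]; exists l.
have [l lP] : exists l : I -> H -> H, forall i u (e : R), 0 < e ->
    \forall a \near F, rnorm (l i u - opf a i u) < e.
  have h i := choice (pointwise opf opfam_rnormB i).
  by exists (fun i => projT1 (h i)) => i; exact: (projT2 (h i)).
have [m mP] : exists m : I -> H -> H, forall i u (e : R), 0 < e ->
    \forall a \near F, rnorm (m i u - opfam_adj_fun a i u) < e.
  have adjB a b i u : rnorm (opfam_adj_fun a i u - opfam_adj_fun b i u)
      <= rnorm (a - b) * rnorm u.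
    have : adjoint_families (opf (a - b))
        (fun i u => opfam_adj_fun a i u - opfam_adj_fun b i u).
      by move=> j v w; rewrite opfamD opfamN hdotBl hdotBr !opfam_adj_funP.
    by move=> /bounded_adjoint; apply; [exact: rnorm_ge0|exact: opfam_rnormP].
  have h i := choice (pointwise opfam_adj_fun adjB i).
  by exists (fun i => projT1 (h i)) => i; exact: (projT2 (h i)).
have lm : adjoint_families l m.
  move=> i u v; apply/eqP; rewrite -subr_eq0 -cmod_eq0 eq_le cmod_ge0 andbT.
  apply/ler_addgt0Pl => e e0; rewrite addr0.
  have n0 : 0 < rnorm u + rnorm v + 1.
    by rewrite ltr_wpDl ?addr_ge0 ?rnorm_ge0.
  have d0 := divr_gt0 e0 n0.
  have [a [la ma]] := filter_ex (filterI (lP i u _ d0) (mP i v _ d0)).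
  have -> : hdot (l i u) v - hdot u (m i v) =
      hdot (l i u - opf a i u) v - hdot u (m i v - opfam_adj_fun a i v).
    by rewrite hdotBl hdotBr opfam_adj_funP opprB addrA subrK.
  apply: le_trans (cmodD _ _) _; rewrite cmodN.
  apply: le_trans (lerD (hdot_CauchySchwarz _ _) (hdot_CauchySchwarz _ _)) _.
  apply: (@le_trans _ _ (e / (rnorm u + rnorm v + 1) * (rnorm u + rnorm v))).
    rewrite mulrDr [leRHS]addrC lerD//; first by rewrite ler_wpM2r ?rnorm_ge0// ltW.
    by rewrite mulrC ler_wpM2r ?rnorm_ge0// ltW.
  by rewrite mulrAC ler_pdivrMr// ler_wpM2l ?lerDl ?ltW.
have limB (M : R) (f : opfam) : (\forall a \near F, rnorm (f - a) < M) ->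
    forall i u, rnorm (opf f i u - l i u) <= M * rnorm u.
  move=> fM i u; apply/ler_addgt0Pl => e e0.
  have [a [fa la]] := filter_ex (filterI fM (lP i u _ e0)).
  apply: le_trans (rnorm_tri (opf a i u) _ _) _; rewrite addrC lerD//.
    by rewrite rnormB ltW.
  apply: le_trans (opfam_rnormB _ _ _ _) _.
  by rewrite ler_wpM2r ?rnorm_ge0// ltW.
have ls : l \in opfam_set.
  apply/mem_set; split; last by exists m.
  have [x xF] := Fc 1 ltr01; exists (1 + rnorm x) => i u.
  rewrite -[l i u](subrK (opf x i u)) (le_trans (rnormD _ _))// mulrDl.
  by rewrite lerD ?opfam_rnormP// rnormB limB.
apply/cvg_ex; exists (exist _ l ls); apply/cvg_rnormP => e e0.
have e4 : 0 < e / 4 by rewrite divr_gt0.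
have [x xF] := Fc _ e4; apply: filterS (xF) => y xy.
apply: (@le_lt_trans _ _ (e / 2)); last by lra.
apply: opfam_rnorm_le; first by rewrite divr_ge0// ltW.
move=> i u; rewrite opfamD opfamN -[opf (exist _ l ls) i u]/(l i u).
apply: le_trans (rnorm_tri (opf x i u) _ _) _.
have -> : e / 2 = e / 4 + e / 4 by field.
rewrite mulrDl lerD//; first by rewrite rnormB; exact: limB.
by apply: le_trans (opfam_rnormB _ _ _ _) _; rewrite ler_wpM2r ?rnorm_ge0 1?ltW.
Qed.

HB.instance Definition _ := Uniform_isComplete.Build opfam opfam_complete.

Let mulA : associative opfam_mul.
Proof. by move=> a b c; exact: opfam_ext. Qed.
Let mulDl : left_distributive opfam_mul +%R.
Proof. by move=> a b c; exact: opfam_ext. Qed.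
Let mulDr : right_distributive opfam_mul +%R.
Proof.
move=> a b c; apply: opfam_ext => i u.
rewrite opfamD !opfam_mulE opfamD.
by have := opfam_lin a i 1 (opf b i u) (opf c i u); rewrite !scale1r.
Qed.
Let mulZl (k : R[i]) a b : opfam_mul (k *: a) b = k *: opfam_mul a b.
Proof. exact: opfam_ext. Qed.
Let mulZr (k : R[i]) a b : opfam_mul a (k *: b) = k *: opfam_mul a b.
Proof.
apply: opfam_ext => i u; apply: hdot_inj => w.
by rewrite opfamZ !opfam_mulE opfamZ hdotZl !(opfam_adjP a) hdotZl.
Qed.

Let rnormMle a b : rnorm (opfam_mul a b) <= rnorm a * rnorm b.
Proof.
apply: opfam_rnorm_le => [|i u]; first by rewrite mulr_ge0 ?rnorm_ge0.
apply: le_trans (opfam_rnormP a i _) _.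
by rewrite -mulrA ler_wpM2l ?rnorm_ge0 ?opfam_rnormP.
Qed.

Let normM a b : `|opfam_mul a b| <= `|a| * `|b|.
Proof. by rewrite !rnormE -rmorphM/= lecR. Qed.

Let adjK : involutive opfam_adj.
Proof.
move=> a; apply: opfam_adj_unique; apply: adjoint_families_sym.
exact: opfam_adjP.
Qed.
Let adjD : {morph opfam_adj : a b / a + b}.
Proof.
move=> a b; apply: opfam_adj_unique => i u v.
by rewrite !opfamD hdotDl hdotDr !opfam_adjP.
Qed.
Let adjZ (k : R[i]) a : opfam_adj (k *: a) = Num.conj k *: opfam_adj a.
Proof.
apply: opfam_adj_unique => i u v.
by rewrite !opfamZ hdotZl hdotZr conjCK opfam_adjP.
Qed.
Let adjM a b : opfam_adj (opfam_mul a b) = opfam_mul (opfam_adj b) (opfam_adj a).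
Proof.
by apply: opfam_adj_unique => i u v; rewrite !opfam_mulE !opfam_adjP.
Qed.

Let norm_adjM a : `|opfam_mul (opfam_adj a) a| = `|a| ^+ 2.
Proof.
rewrite !rnormE -rmorphXn/=; congr (_%:C%C); apply/le_anti/andP; split.
  apply: le_trans (rnormMle _ _) _; rewrite expr2 ler_wpM2r ?rnorm_ge0//.
  by apply: opfam_rnorm_le (rnorm_ge0 _) _; exact: opfam_adj_bounded.
set n := rnorm (opfam_mul _ _); have n0 : 0 <= n by exact: rnorm_ge0.
rewrite -(sqr_sqrtr n0) ler_sqr ?nnegrE ?sqrtr_ge0 ?rnorm_ge0//.
apply: opfam_rnorm_le => [|i u]; first exact: sqrtr_ge0.
rewrite -ler_sqr ?nnegrE ?mulr_ge0 ?sqrtr_ge0 ?rnorm_ge0// exprMn sqr_sqrtr//.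
rewrite -(ger0_norm (sqr_ge0 (rnorm (opf a i u)))) -cmod_real -hdot_rnorm.
rewrite opfam_adjP -opfam_mulE; apply: le_trans (hdot_CauchySchwarz _ _) _.
rewrite [X in _ <= _ * X]expr2 mulrA [leLHS]mulrC ler_wpM2r ?rnorm_ge0//.
exact: opfam_rnormP.
Qed.

HB.instance Definition _ :=
  CompleteNormedModule_isCStarAlgebra.Build R opfam
    mulA mulDl mulDr mulZl mulZr normM adjK adjD adjZ adjM norm_adjM.

Lemma opfam_cmulE a b i u : opf (cmul a b) i u = opf a i (opf b i u).
Proof. by []. Qed.

Lemma opfam_hdot_adj a i u v : hdot (opf a i u) v = hdot u (opf (adj a) i v).
Proof. exact: opfam_adjP. Qed.

Lemma opfam_adjE a b : adjoint_families (opf a) (opf b) -> adj a = b.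
Proof. exact: opfam_adj_unique. Qed.

End OperatorFamilies.

(** * Square-summable complex sequences *)

Section ComplexSums.
Variable R : realType.
Implicit Types (z w : nat -> R[i]) (s t : R[i]).

Lemma complex_cauchy_cvg (T : Type) (F : set_system T) (FF : ProperFilter F)
    (g : T -> R[i]) :
  (forall e : R, 0 < e -> exists x, \forall y \near F, cmod (x - g y) < e) ->
  exists l, forall e : R, 0 < e -> \forall y \near F, cmod (l - g y) < e.
Proof.
move=> gc.
have part (h : R[i] -> R) : (forall x y, `|h x - h y| <= cmod (x - y)) ->
    exists l, forall e : R, 0 < e -> \forall y \near F, `|l - h (g y)| < e.
  move=> hL; have : cauchy ((h \o g) @ F).
    apply/cauchyP => e e0; have [x xF] := gc e e0; exists (h x).
    apply: filterS xF => y xy; rewrite /= -ball_normE /=; move: xy.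
    exact: le_lt_trans.
  by move=> /cauchy_cvg/cvg_ex[l /cvgrPdist_lt]; exists l.
have [|a aP] := part (@complex.Re R).
  by move=> x y; rewrite -raddfB; exact: Re_le_cmod.
have [|b bP] := part (@complex.Im R).
  by move=> x y; rewrite -raddfB; exact: Im_le_cmod.
exists (a +i* b)%C => e e0; have e2 : 0 < e / 2 by rewrite divr_gt0.
apply: filterS2 (aP _ e2) (bP _ e2) => y ay yb.
apply: le_lt_trans (cmod_le_ReIm _) _.
by move: ay yb; rewrite !raddfB/=; lra.
Qed.

Definition sums_to z s : Prop := forall e : R, 0 < e ->
  \forall N \near \oo, cmod (s - \sum_(n < N) z n) < e.

Lemma sums_to_unique z s t : sums_to z s -> sums_to z t -> s = t.
Proof.
move=> zs zt; apply/eqP; rewrite -subr_eq0 -cmod_eq0 eq_le cmod_ge0 andbT.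
apply/ler_addgt0Pl => e e0; rewrite addr0.
have e2 : 0 < e / 2 by rewrite divr_gt0.
have [N [sN tN]] := filter_ex (filterI (zs _ e2) (zt _ e2)).
have -> : s - t = (s - \sum_(n < N) z n) - (t - \sum_(n < N) z n) by ring.
by apply: le_trans (cmodD _ _) _; rewrite cmodN; lra.
Qed.

Lemma sums_to_lin k z w s t : sums_to z s -> sums_to w t ->
  sums_to (fun n => k * z n + w n) (k * s + t).
Proof.
move=> zs wt e e0; have k1 : 0 < cmod k + 1 by rewrite ltr_wpDl ?cmod_ge0.
have e2 : 0 < e / 2 by rewrite divr_gt0.
apply: filterS2 (zs _ (divr_gt0 e2 k1)) (wt _ e2) => N sN tN.
rewrite big_split/= -mulr_sumr.
rewrite (_ : _ - _ = k * (s - \sum_(n < N) z n) + (t - \sum_(n < N) w n)); last by ring.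
apply: le_lt_trans (cmodD _ _) _; rewrite cmodM.
move: sN; rewrite ltr_pdivlMr// mulrDr mulr1 => sN.
have := cmod_ge0 (s - \sum_(n < N) z n); rewrite (mulrC (cmod k)); lra.
Qed.

Lemma sums_to_conj z s : sums_to z s ->
  sums_to (fun n => Num.conj (z n)) (Num.conj s).
Proof.
move=> zs e /zs; apply: filterS => N.
by rewrite -raddf_sum -raddfB cmod_conj.
Qed.

Lemma sums_to_exists z (M : R) :
  (forall N, \sum_(n < N) cmod (z n) <= M) -> exists s, sums_to z s.
Proof.
move=> zM; apply: complex_cauchy_cvg => e e0.
pose P N := \sum_(n < N) cmod (z n).
have Pm m n : cmod (\sum_(i < m) z i - \sum_(i < m + n) z i) <= P (m + n)%N - P m.
  elim: n => [|n IH]; first by rewrite addn0 !subrr cmod0.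
  rewrite addnS /P !big_ord_recr/= opprD addrA.
  apply: le_trans (cmodD _ _) _; rewrite cmodN.
  by rewrite -/(P (m + n)%N) -/(P m) addrAC lerD2r.
have Pnd : {homo P : n m / (n <= m)%N >-> n <= m}.
  move=> m n /subnKC <-; rewrite -subr_ge0.
  exact: le_trans (cmod_ge0 _) (Pm _ _).
have /(nondecreasing_is_cvgn Pnd)/cvg_ex[l /cvgrPdist_lt Pl] : has_ubound (range P).
  by exists M => _ [N _ <-]; exact: zM.
have [N _ NP] := Pl _ (divr_gt0 e0 (ltr0Sn _ 1)).
exists (\sum_(n < N) z n); exists N => // m /= Nm.
rewrite -(subnKC Nm); apply: le_lt_trans (Pm _ _) _; rewrite subnKC//.
have := NP m Nm; have := NP N (leqnn _).
rewrite !ltr_norml => /andP[h1 h2] /andP[h3 h4]; lra.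
Qed.

End ComplexSums.

Section Ell2.
Variable R : realType.

Definition sqsum (f : nat -> R[i]) N : R := \sum_(n < N) cmod (f n) ^+ 2.

Definition ell2_set : set (nat -> R[i]^o) :=
  [set f | exists M, forall N, sqsum f N <= M].

Definition ell2 : Type := {f : nat -> R[i]^o | f \in ell2_set}.

HB.instance Definition _ := [isSub of ell2 for @sval (nat -> R[i]^o) _].
HB.instance Definition _ := [Choice of ell2 by <:].

Lemma ell2_set_lin (k : R[i]) f g :
  ell2_set f -> ell2_set g -> ell2_set (fun n => k * f n + g n).
Proof.
move=> [M fM] [N gN]; exists (2 * (cmod k ^+ 2 * M + N)) => m.
apply: (@le_trans _ _ (2 * (cmod k ^+ 2 * sqsum f m + sqsum g m))); last first.
  by rewrite ler_pM2l// lerD// ler_wpM2l ?sqr_ge0.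
rewrite /sqsum mulr_sumr -big_split mulr_sumr; apply: ler_sum => n _ /=.
have h1 := cmodD (k * f n) (g n); rewrite cmodM in h1.
rewrite -exprMn; apply: (@le_trans _ _ ((cmod k * cmod (f n) + cmod (g n)) ^+ 2)).
  by rewrite ler_sqr ?nnegrE ?addr_ge0 ?mulr_ge0 ?cmod_ge0.
have := sqr_ge0 (cmod k * cmod (f n) - cmod (g n)); lra.
Qed.

Lemma ell2_set0 : ell2_set (fun=> 0).
Proof.
by exists 0 => N; rewrite /sqsum big1// => n _; rewrite cmod0 expr0n.
Qed.

Lemma ell2_submod : subsemimod_closed (mem ell2_set).
Proof.
split; first split.
- exact/mem_set/ell2_set0.
- move=> f g /set_mem lf /set_mem lg; apply/mem_set.
  have := ell2_set_lin 1 lf lg; congr ell2_set.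
  by apply/funext => n; rewrite mul1r.
- move=> k f /set_mem lf; apply/mem_set.
  have := ell2_set_lin k lf ell2_set0; congr ell2_set.
  by apply/funext => n; rewrite addr0.
Qed.

HB.instance Definition _ :=
  GRing.SubChoice_isSubLmodule.Build R[i] (nat -> R[i]^o) (mem ell2_set) ell2
    ell2_submod.

Implicit Types f g h : ell2.

Definition coord f (n : nat) : R[i] := sval f n.

Lemma ell2_ext f g : coord f =1 coord g -> f = g.
Proof. by move=> fg; apply: val_inj; apply/funext. Qed.

Lemma coordD f g n : coord (f + g) n = coord f n + coord g n.
Proof. by []. Qed.

Lemma coordZ (k : R[i]) f n : coord (k *: f) n = k * coord f n.
Proof. by []. Qed.

Lemma coordN f n : coord (- f) n = - coord f n.
Proof. by []. Qed.

Lemma coordP f : ell2_set (coord f).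
Proof. exact/set_mem/(valP f). Qed.

Lemma ell2_dot_exists f g :
  exists s, sums_to (fun n => coord f n * Num.conj (coord g n)) s.
Proof.
have [M fM] := coordP f; have [N gN] := coordP g.
apply: (@sums_to_exists _ _ (M + N)) => m.
apply: le_trans (lerD (fM m) (gN m)).
rewrite -big_split; apply: ler_sum => n _ /=; rewrite cmodM cmod_conj.
have := sqr_ge0 (cmod (coord f n) - cmod (coord g n)).
by have := mulr_ge0 (cmod_ge0 (coord f n)) (cmod_ge0 (coord g n)); lra.
Qed.

Definition ell2_dot f g : R[i] := sval (cid (ell2_dot_exists f g)).

Lemma ell2_dotP f g :
  sums_to (fun n => coord f n * Num.conj (coord g n)) (ell2_dot f g).
Proof. exact: (svalP (cid (ell2_dot_exists f g))). Qed.

Lemma ell2_dotC f g : ell2_dot f g = Num.conj (ell2_dot g f).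
Proof.
apply: sums_to_unique (ell2_dotP f g) _.
rewrite (_ : (fun _ => _) = fun n => Num.conj (coord g n * Num.conj (coord f n))).
  by apply: sums_to_conj; exact: ell2_dotP.
by apply/funext => n; rewrite rmorphM/= conjCK mulrC.
Qed.

Lemma ell2_dot_linl g (k : R[i]) f h :
  ell2_dot (k *: f + h) g = k * ell2_dot f g + ell2_dot h g.
Proof.
apply: sums_to_unique (ell2_dotP _ _) _.
have := sums_to_lin k (ell2_dotP f g) (ell2_dotP h g); congr sums_to.
by apply/funext => n; rewrite coordD coordZ mulrDl mulrA.
Qed.

Lemma ell2_dot_bilinear : bilinear_for
  (GRing.Scale.Law.clone _ _ *%R _)
  (GRing.Scale.Law.clone _ _ (@Num.conj R[i] \; *%R) _) ell2_dot.
Proof.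
split=> [g|g] k f h /=; first exact: ell2_dot_linl.
by rewrite ell2_dotC ell2_dot_linl rmorphD rmorphM/= -!ell2_dotC.
Qed.

HB.instance Definition _ := bilinear_isBilinear.Build R[i] ell2 ell2 R[i] _ _
  ell2_dot ell2_dot_bilinear.

Lemma ell2_dot_hermitian f g :
  ell2_dot f g = (-1) ^+ false * Num.conj (ell2_dot g f).
Proof. by rewrite expr0 mul1r; exact: ell2_dotC. Qed.

HB.instance Definition _ := isHermitianSesquilinear.Build R[i] ell2 false
  (@Num.conj R[i]) ell2_dot ell2_dot_hermitian.

Definition ell2_sq f : R := complex.Re (ell2_dot f f).

Lemma ell2_dot_real f : ell2_dot f f = (ell2_sq f)%:C%C.
Proof.
rewrite /ell2_sq; have := ell2_dotC f f.
by case: (ell2_dot f f) => a b [] /eqP; rewrite -addr_eq0 -mulr2n mulrn_eq0 => /eqP ->.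
Qed.

Lemma sqsum_real f N :
  \sum_(n < N) (coord f n * Num.conj (coord f n)) = (sqsum (coord f) N)%:C%C.
Proof. by rewrite rmorph_sum/=; apply: eq_bigr => n _; rewrite mul_conj_cmod. Qed.

Lemma sqsum_nd (z : nat -> R[i]) m n : (m <= n)%N -> sqsum z m <= sqsum z n.
Proof.
move=> /subnKC <-; elim: (n - m)%N => [|k IH]; first by rewrite addn0.
by rewrite addnS /sqsum big_ord_recr/= (le_trans IH)// lerDl sqr_ge0.
Qed.

Lemma sqsum_le_ell2_sq f N : sqsum (coord f) N <= ell2_sq f.
Proof.
apply/ler_addgt0Pl => e e0.
have [m _ /(_ (maxn m N) (leq_maxl _ _))] := ell2_dotP f f e0.
rewrite sqsum_real ell2_dot_real -rmorphB cmod_real ltr_norml => /andP[h _].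
have := sqsum_nd (coord f) (leq_maxr m N); lra.
Qed.

Lemma ell2_sq_le f M : (forall N, sqsum (coord f) N <= M) -> ell2_sq f <= M.
Proof.
move=> fM; apply/ler_addgt0Pl => e e0.
have [m _ /(_ m (leqnn _))] := ell2_dotP f f e0.
rewrite sqsum_real ell2_dot_real -rmorphB cmod_real ltr_norml => /andP[_ h].
by have := fM m; lra.
Qed.

Lemma coord_le_sq f n : cmod (coord f n) ^+ 2 <= ell2_sq f.
Proof.
apply: le_trans (sqsum_le_ell2_sq f n.+1).
by rewrite /sqsum big_ord_recr/= lerDr sumr_ge0// => i _; exact: sqr_ge0.
Qed.

Lemma ell2_dot_pos f : f != 0 -> 0 < ell2_dot f f.
Proof.
move=> f0; rewrite ell2_dot_real ltcR lt_def; apply/andP; split; last first.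
  by apply: le_trans (coord_le_sq f 0); exact: sqr_ge0.
apply: contra f0 => /eqP fs; apply/eqP/ell2_ext => n; apply/eqP.
by rewrite -cmod_eq0 -sqrf_eq0 eq_le sqr_ge0 andbT -fs; exact: coord_le_sq.
Qed.

HB.instance Definition _ := isDotProduct.Build R[i] ell2 ell2_dot ell2_dot_pos.

Let form : {dot ell2 for (@Num.conj R[i])} := ell2_dot.

Definition ell2_norm f : R := Num.sqrt (ell2_sq f).

Lemma ell2_sq_ge0 f : 0 <= ell2_sq f.
Proof. by apply: le_trans (coord_le_sq f 0); exact: sqr_ge0. Qed.

Let cnorm f : R[i] := (ell2_norm f)%:C%C.

Let cnormD f g : cnorm (f + g) <= cnorm f + cnorm g.
Proof.
rewrite /cnorm -rmorphD/= lecR /ell2_norm -ler_sqr ?nnegrE ?addr_ge0 ?sqrtr_ge0//.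
rewrite sqrrD !sqr_sqrtr ?ell2_sq_ge0//.
have /= := @dnormD _ _ form f g.
rewrite /form/= !ell2_dot_real => /(congr1 (@complex.Re R)) /=.
rewrite !raddfD/= => ->; set d := ell2_dot f g.
have h : complex.Re d <= Num.sqrt (ell2_sq f) * Num.sqrt (ell2_sq g).
  apply: le_trans (ler_norm _) _; apply: le_trans (Re_le_cmod _) _.
  rewrite -ler_sqr ?nnegrE ?mulr_ge0 ?sqrtr_ge0 ?cmod_ge0// exprMn.
  rewrite !sqr_sqrtr ?ell2_sq_ge0//; exact: (dot_CauchySchwarz form f g).
have -> : complex.Re (Num.conj d) = complex.Re d by case: (d).
lra.
Qed.

Let cnormZ (k : R[i]) f : cnorm (k *: f) = `|k| * cnorm f.
Proof.
rewrite /cnorm cmodE -rmorphM/=; congr (_%:C%C); rewrite /ell2_norm.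
have -> : ell2_sq (k *: f) = cmod k ^+ 2 * ell2_sq f.
  have := @dnormZ _ _ form k f; rewrite /form/= !ell2_dot_real cmodE.
  by rewrite -rmorphXn -rmorphM => /complexI.
by rewrite sqrtrM ?sqr_ge0// sqrtr_sqr ger0_norm ?cmod_ge0.
Qed.

Let cnorm0 f : cnorm f = 0 -> f = 0.
Proof.
move=> /complexI/eqP; rewrite sqrtr_eq0 => f0; apply/eqP; apply: contraTT f0.
by move=> /ell2_dot_pos; rewrite ell2_dot_real ltcR ltNge.
Qed.

HB.instance Definition _ :=
  Lmodule_isNormed.Build R[i] ell2 cnormD cnormZ cnorm0.

Lemma ell2_rnorm_sqr f : rnorm f ^+ 2 = ell2_sq f.
Proof. by rewrite -[rnorm f]/(ell2_norm f) sqr_sqrtr ?ell2_sq_ge0. Qed.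

Lemma coord_le_rnorm f n : cmod (coord f n) <= rnorm f.
Proof.
by rewrite -ler_sqr ?nnegrE ?cmod_ge0 ?rnorm_ge0// ell2_rnorm_sqr coord_le_sq.
Qed.

Lemma ell2_rnorm_le f (M : R) : 0 <= M ->
  (forall N, sqsum (coord f) N <= M ^+ 2) -> rnorm f <= M.
Proof.
move=> M0 fM; rewrite -ler_sqr ?nnegrE ?rnorm_ge0// ell2_rnorm_sqr.
exact: ell2_sq_le.
Qed.

Lemma ell2_complete (F : set_system ell2) : ProperFilter F -> cauchy F -> cvg F.
Proof.
move=> FF /cauchy_rnormP Fc.
have [l lP] : exists l : nat -> R[i], forall n (e : R), 0 < e ->
    \forall f \near F, cmod (l n - coord f n) < e.
  have h n : exists l, forall e : R, 0 < e ->
      \forall f \near F, cmod (l - coord f n) < e.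
    apply: complex_cauchy_cvg => e e0; have [x xF] := Fc e e0.
    exists (coord x n); apply: filterS xF => y; apply: le_lt_trans.
    exact: (coord_le_rnorm (x - y)).
  by exists (fun n => projT1 (cid (h n))) => n; exact: (projT2 (cid (h n))).
have sumlim (f : ell2) (e : R) : 0 <= e -> (\forall g \near F, rnorm (f - g) < e) ->
    forall N, sqsum (fun n => l n - coord f n) N <= e ^+ 2.
  move=> e0 fF N.
  have cvgN : (fun g => sqsum (fun n => coord g n - coord f n) N) @ F -->
      sqsum (fun n => l n - coord f n) N.
    elim: N => [|N IH]; rewrite /sqsum.
      by under eq_fun do rewrite big_ord0; rewrite big_ord0; exact: cvg_cst.
    under eq_fun do rewrite big_ord_recr/=; rewrite big_ord_recr/=.
    apply: cvgD IH _.
    have c1 : (fun g => cmod (coord g N - coord f N)) @ F --> cmod (l N - coord f N).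
      apply/cvgrPdist_lt => d d0; apply: filterS (lP N d d0) => g.
      apply: le_lt_trans.
      have := @rnorm_lip _ R[i]^o (l N - coord f N) (coord g N - coord f N).
      by rewrite opprB addrA subrK.
    by rewrite expr2; under eq_fun do rewrite expr2; exact: cvgM.
  apply: (closed_cvg (fun x : R => x <= e ^+ 2) (@closed_le _ _)) cvgN.
  apply: filterS fF => g fg.
  apply: le_trans (_ : rnorm (g - f) ^+ 2 <= _).
    by rewrite ell2_rnorm_sqr; exact: (sqsum_le_ell2_sq (g - f)).
  by rewrite rnormB ler_sqr ?nnegrE ?rnorm_ge0// ltW.
have ls : (l : nat -> R[i]^o) \in ell2_set.
  have [x xF] := Fc 1 ltr01; apply/mem_set.
  have d : ell2_set (fun n => l n - coord x n).
    by exists (1 ^+ 2) => N; exact: sumlim.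
  have := ell2_set_lin 1 d (coordP x); congr ell2_set.
  by apply/funext => n; rewrite mul1r subrK.
pose L : ell2 := exist _ (l : nat -> R[i]^o) ls.
apply/cvg_ex; exists L; apply/cvg_rnormP => e e0.
have e4 : 0 < e / 4%:R by rewrite divr_gt0.
have [x xF] := Fc _ e4; apply: filterS (xF) => y xy.
apply: le_lt_trans (rnorm_tri x _ _) _.
have : rnorm (L - x) <= e / 4%:R.
  apply: ell2_rnorm_le; first exact: ltW.
  by apply: (sumlim x (e / 4%:R)) => //; exact: ltW.
lra.
Qed.

HB.instance Definition _ := Uniform_isComplete.Build ell2 ell2_complete.

Lemma ell2_dot_norm f : `|f| ^+ 2 = form f f.
Proof. by rewrite rnormE -rmorphXn/= ell2_rnorm_sqr -ell2_dot_real. Qed.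

HB.instance Definition _ :=
  CompleteNormedModule_isHilbert.Build R ell2 ell2_dot_norm.

Lemma sqsum_unit m N : sqsum (fun n => (n == m)%:R) N <= 1.
Proof.
elim: N => [|N IH]; first by rewrite /sqsum big_ord0 ler01.
have cmod1 : cmod (1 : R[i]) = 1.
  by rewrite -(rmorph1 (real_complex R)) cmod_real normr1.
rewrite /sqsum big_ord_recr/=; have [<-|Nm] := eqVneq N m.
  rewrite big1 ?add0r ?cmod1 ?expr1n// => i _.
  by rewrite (ltn_eqF (ltn_ord i)) cmod0 expr0n.
by rewrite cmod0 expr0n/= addr0.
Qed.

Lemma ell2_unit_subproof m : (fun n => (n == m)%:R : R[i]^o) \in ell2_set.
Proof. by apply/mem_set; exists 1; exact: sqsum_unit. Qed.

Definition ell2_unit m : ell2 :=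
  exist _ (fun n => (n == m)%:R : R[i]^o) (ell2_unit_subproof m).

End Ell2.

(** Infinite dimension enters only here: a separated sequence in the unit ball
    keeps the operators close to the identity from being compact. *)
Lemma ell2_separated (R : realType) : exists e : nat -> ell2 R,
  (forall n, rnorm (e n) <= 1) /\
  (forall m n, m != n -> 1 <= rnorm (e m - e n)).
Proof.
exists (@ell2_unit R); split=> [n|m n mn].
  by apply: ell2_rnorm_le => // N; rewrite expr1n; exact: sqsum_unit.
apply: le_trans (coord_le_rnorm _ m).
rewrite coordD coordN /coord/= eqxx (negbTE mn) subr0.
by rewrite -(rmorph1 (real_complex R)) cmod_real normr1.
Qed.

(** * Ideals generated by corner elements *)

Section SpannedSubalgebras.
Variables (R : realType) (A : cstarAlgType R).
Implicit Types (S : set A) (J : csubalg A).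

Definition csub_in J (x : A) (Jx : csubalg_set J x) : csub J :=
  exist _ x (mem_set Jx).

Lemma csub_valP J (x : csub J) : csubalg_set J (val x).
Proof. exact/set_mem/(valP x). Qed.

Lemma csub_val_lin J (k : R[i]) (x y : csub J) :
  val (k *: x + y) = k *: val x + val y.
Proof. exact: linearP. Qed.

Lemma csub_rnormB J (x y : csub J) : rnorm (x - y) = rnorm (val x - val y).
Proof. by rewrite -[LHS]/(rnorm (val (x - y))) raddfB. Qed.

(** An induction principle: the elements of a spanned subalgebra which satisfy a
    closed linear condition form a closed subspace of the ambient algebra. *)
Lemma csub_cspan_ind J S (W : set (csub J)) :
  csubalg_set J = cspan S -> lin_subspace W -> closed W ->
  (forall x : csub J, S (val x) -> W x) -> forall x, W x.
Proof.
move=> JS lW cW SW x.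
have : cspan S (val x) by rewrite -JS; exact: csub_valP.
suff /[apply] : cspan S `<=` [set a | exists2 y : csub J, val y = a & W y].
  by move=> [y /val_inj <-].
apply: cspan_ind.
- split=> [|k _ _ [y <- Wy] [z <- Wz]].
    by exists 0; [exact: raddf0|exact: subspace0].
  exists (k *: y + z); last by apply: lW.2.
  exact: linearP.
- apply/closed_rnormP => a h.
  have Ja : csubalg_set J a.
    apply: (closed_rnormP _).1 (csubalg_closed (c := J)) _ _ => e /h[b [y <- _] ay].
    by exists (val y) => //; exact: csub_valP.
  exists (csub_in Ja) => //; apply: (closed_rnormP _).1 cW _ _ => e /h[_ [y <- Wy] ay].
  by exists y.
- move=> a Sa; have Ja : csubalg_set J a by rewrite JS; exact: sub_cspan.
  by exists (csub_in Ja) => //; exact: SW.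
Qed.

Lemma cspan_ideal S :
  (forall a s, S s -> cspan S (cmul a s)) ->
  (forall a s, S s -> cspan S (cmul s a)) ->
  (forall s, S s -> cspan S (adj s)) ->
  exists L : csubalg A, csubalg_set L = cspan S /\ closed_ideal L.
Proof.
move=> Sl Sr Sa.
have l a x : cspan S x -> cspan S (cmul a x).
  move: x; apply: cspan_ind (Sl a).
  - by apply: linear_preimage (cspan_lin S); exact: cmull_linear.
  - by apply: closed_preimage (@cspan_closed _ _ S); exact: cmull_continuous.
have r a x : cspan S x -> cspan S (cmul x a).
  move: x; apply: cspan_ind (Sr a).
  - by apply: linear_preimage (cspan_lin S); exact: cmulr_linear.
  - by apply: closed_preimage (@cspan_closed _ _ S); exact: cmulr_continuous.
have s x : cspan S x -> cspan S (adj x).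
  move: x; apply: cspan_ind Sa.
  - by apply: adj_preimage_lin; exact: cspan_lin.
  - by apply: closed_preimage (@cspan_closed _ _ S); exact: adj_continuous.
have m x y : cspan S x -> cspan S y -> cspan S (cmul x y) by move=> _; exact: l.
exists (CSubalg (cspan_lin S) m s (@cspan_closed _ _ S)); split => //.
by split => //; [exact: cspan_lin|exact: cspan_closed].
Qed.

Lemma cspan_liminal_ideal S :
  (forall a s, S s -> cspan S (cmul a s)) ->
  (forall a s, S s -> cspan S (cmul s a)) ->
  (forall s, S s -> cspan S (adj s)) -> S `<=` @corner R A ->
  exists L : csubalg A, csubalg_set L = cspan S /\ liminal_ideal L.
Proof.
move=> Sl Sr Sa Sc; have [L [LS iL]] := cspan_ideal Sl Sr Sa.
exists L; split => //; split => //; apply: liminal_of_corners.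
apply/seteqP; split => // x _; move: x.
apply: (csub_cspan_ind LS); [exact: cspan_lin|exact: cspan_closed|].
move=> x Sx; apply: sub_cspan => y; have [k xyx] := Sc _ Sx (val y).
by exists k; apply: val_inj; rewrite linearZ/= -xyx.
Qed.

End SpannedSubalgebras.

(** * The fibers *)

Section Fibers.
Variables (R : realType) (I : eqType) (H : hilbertType R).
Local Notation opfam := (opfam I H).
Implicit Types (r s t i : I) (u v w : H) (a x : opfam).

Lemma opf0 a i : opf a i 0 = 0.
Proof.
have := opfam_lin a i 1 0 0; rewrite !scale1r addr0 => /eqP.
by rewrite -subr_eq subrr => /eqP <-.
Qed.

Lemma opfZ a i (k : R[i]) u : opf a i (k *: u) = k *: opf a i u.
Proof. by have := opfam_lin a i k u 0; rewrite !addr0 opf0 addr0. Qed.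

Lemma opfB a i u v : opf a i (u - v) = opf a i u - opf a i v.
Proof. by have := opfam_lin a i (-1) v u; rewrite !scaleN1r !(addrC (- _)). Qed.

Let rank1_fun r u v : I -> H -> H :=
  fun i w => if i == r then hdot w v *: u else 0.

Let rank1_adj r u v : adjoint_families (rank1_fun r u v) (rank1_fun r v u).
Proof.
move=> i w z; rewrite /rank1_fun; case: ifP => _; last by rewrite hdot0l hdot0r.
by rewrite hdotZl hdotZr -hdotC mulrC.
Qed.

Let rank1_subproof r u v : rank1_fun r u v \in @opfam_set R I H.
Proof.
apply/mem_set; split; last by exists (rank1_fun r v u); exact: rank1_adj.
exists (rnorm v * rnorm u) => i w; rewrite /rank1_fun; case: ifP => _.
  rewrite rnormZ mulrAC ler_wpM2r ?rnorm_ge0// mulrC.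
  exact: hdot_CauchySchwarz.
by rewrite rnorm0 !mulr_ge0 ?rnorm_ge0.
Qed.

(** The rank-one operator $\theta_{u,v}\colon w\mapsto\langle w,v\rangle u$ in
    component $r$. *)
Definition rank1 r u v : opfam := exist _ (rank1_fun r u v) (rank1_subproof r u v).

Let comp1_fun r : I -> H -> H := fun i w => if i == r then w else 0.

Let comp1_adj r : adjoint_families (comp1_fun r) (comp1_fun r).
Proof.
by move=> i w z; rewrite /comp1_fun; case: ifP => _ //; rewrite hdot0l hdot0r.
Qed.

Let comp1_subproof r : comp1_fun r \in @opfam_set R I H.
Proof.
apply/mem_set; split; last by exists (comp1_fun r); exact: comp1_adj.
exists 1 => i w; rewrite /comp1_fun mul1r; case: ifP => _ //.
by rewrite rnorm0 rnorm_ge0.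
Qed.

Definition comp1 r : opfam := exist _ (comp1_fun r) (comp1_subproof r).

Lemma rank1E r u v i w : opf (rank1 r u v) i w = if i == r then hdot w v *: u else 0.
Proof. by []. Qed.

Lemma comp1E r i w : opf (comp1 r) i w = if i == r then w else 0.
Proof. by []. Qed.

Lemma adj_rank1 r u v : adj (rank1 r u v) = rank1 r v u.
Proof. by apply: opfam_adjE; exact: rank1_adj. Qed.

Lemma adj_comp1 r : adj (comp1 r) = comp1 r.
Proof. by apply: opfam_adjE; exact: comp1_adj. Qed.

Lemma cmul_rank1 a r u v : cmul a (rank1 r u v) = rank1 r (opf a r u) v.
Proof.
apply: opfam_ext => i w; rewrite opfam_cmulE !rank1E.
by case: eqVneq => [->|_]; [rewrite opfZ|rewrite opf0].
Qed.

Lemma rank1_cmul a r u v : cmul (rank1 r u v) a = rank1 r u (opf (adj a) r v).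
Proof.
apply: opfam_ext => i w; rewrite opfam_cmulE !rank1E.
by case: eqVneq => [->|_] //; rewrite opfam_hdot_adj.
Qed.

Lemma rank1Z (k : R[i]) r u v : rank1 r (k *: u) v = k *: rank1 r u v.
Proof.
apply: opfam_ext => i w; rewrite opfamZ !rank1E.
by case: ifP => _; rewrite ?scaler0// !scalerA mulrC.
Qed.

(** A rank-one operator has one-dimensional corner
    $\theta a\theta=\langle au,v\rangle\theta$. *)
Lemma rank1_corner a r u v : cmul (cmul (rank1 r u v) a) (rank1 r u v) =
  hdot (opf a r u) v *: rank1 r u v.
Proof.
by rewrite rank1_cmul cmul_rank1 rank1E eqxx -opfam_hdot_adj rank1Z.
Qed.

Lemma comp1_mul r s : cmul (comp1 r) (comp1 s) = if r == s then comp1 r else 0.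
Proof.
apply: opfam_ext => i w; rewrite opfam_cmulE !comp1E.
have [->|rs] := eqVneq r s; first by rewrite comp1E; case: (i == s).
rewrite opfam0; case: eqVneq => [->|//]; case: eqVneq => // rs'.
by rewrite rs' eqxx in rs.
Qed.

Definition gens t : set opfam :=
  [set x | (exists r u v, r != t /\ x = rank1 r u v) \/ exists r, x = comp1 r].

Lemma gens_rank1 t r u v : r != t -> gens t (rank1 r u v).
Proof. by move=> rt; left; exists r, u, v. Qed.

Lemma gens_comp1 t r : gens t (comp1 r).
Proof. by right; exists r. Qed.

Lemma gens_adj t x : gens t x -> cspan (gens t) (adj x).
Proof.
move=> [[r [u [v [rt ->]]]]|[r ->]]; apply: sub_cspan.
  by rewrite adj_rank1; exact: gens_rank1.
by rewrite adj_comp1; exact: gens_comp1.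
Qed.

Lemma gens_mul t x y : gens t x -> gens t y -> cspan (gens t) (cmul x y).
Proof.
move=> gx [[r [u [v [rt ->]]]]|[r ->]].
  by rewrite cmul_rank1; apply: sub_cspan; exact: gens_rank1.
case: gx => [[s [u [v [st ->]]]]|[s ->]].
  by rewrite rank1_cmul; apply: sub_cspan; exact: gens_rank1.
rewrite comp1_mul; case: ifP => _; first by apply: sub_cspan; exact: gens_comp1.
exact: (subspace0 (cspan_lin _)).
Qed.

Lemma fiber_mul t x y :
  cspan (gens t) x -> cspan (gens t) y -> cspan (gens t) (cmul x y).
Proof.
move=> + gy; move: x; apply: cspan_ind.
- by apply: linear_preimage (cspan_lin _); exact: cmulr_linear.
- by apply: closed_preimage (@cspan_closed _ _ _); exact: cmulr_continuous.
move=> x gx /=; move: y gy; apply: cspan_ind.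
- by apply: linear_preimage (cspan_lin _); exact: cmull_linear.
- by apply: closed_preimage (@cspan_closed _ _ _); exact: cmull_continuous.
by move=> y; exact: gens_mul.
Qed.

Lemma fiber_adj t x : cspan (gens t) x -> cspan (gens t) (adj x).
Proof.
move: x; apply: cspan_ind.
- by apply: adj_preimage_lin; exact: cspan_lin.
- by apply: closed_preimage (@cspan_closed _ _ _); exact: adj_continuous.
exact: gens_adj.
Qed.

(** The $c_0$-direct sum over $r$ of the algebras $\mathbb C 1+K(H)$, where
    the component $r=t$ is restricted to $\mathbb C 1$. *)
Definition fiber_alg t : csubalg opfam :=
  CSubalg (cspan_lin (gens t)) (@fiber_mul t) (@fiber_adj t)
    (@cspan_closed _ _ (gens t)).

Definition fiber t : cstarAlgType R := csub (fiber_alg t).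

Lemma fiber_valP t (x : fiber t) : cspan (gens t) (val x).
Proof. exact: (csub_valP x). Qed.

Definition fiber_in t x (gx : gens t x) : fiber t :=
  @csub_in _ _ (fiber_alg t) x (sub_cspan gx).

Lemma fiber_ind t (W : set (fiber t)) : lin_subspace W -> closed W ->
  (forall (x : fiber t) r u v, r != t -> val x = rank1 r u v -> W x) ->
  (forall (x : fiber t) r, val x = comp1 r -> W x) ->
  forall x : fiber t, W x.
Proof.
move=> lW cW W1 W2; apply: (@csub_cspan_ind _ _ (fiber_alg t) (gens t)) => //.
by move=> x [[r [u [v [rt xE]]]]|[r xE]]; [exact: W1 xE|exact: W2 xE].
Qed.

End Fibers.

(** * The fibers are postliminal *)

Section Postliminal.
Variables (R : realType) (I : eqType) (H : hilbertType R) (t : I).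
Local Notation A := (fiber H t).
Variables (J : set A) (Q : cstarAlgType R) (q : A -> Q).
Hypothesis qJ : is_quotient J q.
Hypothesis idJ : closed_ideal J.

Let q_star : star_morphism q. Proof. by case: qJ. Qed.
Let q_lin (k : R[i]) x y : q (k *: x + y) = k *: q x + q y.
Proof. by case: q_star. Qed.
Let q_mul x y : q (cmul x y) = cmul (q x) (q y).
Proof. by case: q_star. Qed.
Let q_adj x : q (adj x) = adj (q x).
Proof. by case: q_star. Qed.
Let q_surj z : exists a, q a = z. Proof. by case: qJ => _ /(_ z). Qed.

Let q0 : q 0 = 0.
Proof.
have := q_lin 1 0 0; rewrite !scale1r addr0 => /eqP.
by rewrite -subr_eq subrr => /eqP <-.
Qed.

Let qZ (k : R[i]) x : q (k *: x) = k *: q x.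
Proof. by have := q_lin k x 0; rewrite !addr0 q0 addr0. Qed.

Let q_norm a : rnorm (q a) <= rnorm a.
Proof.
have [_ _ _ ->] := qJ; apply: ge_inf.
  by exists 0 => _ [j _ <-]; exact: rnorm_ge0.
by exists 0; [case: idJ => -[]|rewrite addr0].
Qed.

Let q_continuous : continuous q.
Proof.
apply: (@rnorm_lipschitz_continuous _ _ _ _ 1) => x y; rewrite mul1r.
have -> : q x - q y = q (x - y).
  by have := q_lin (-1) y x; rewrite !scaleN1r (addrC _ x) (addrC _ (q x)) => ->.
exact: q_norm.
Qed.

(** Since $a\theta_{u,v}=\theta_{au,v}$, the rank-one operators span an ideal; by
    surjectivity their images are still corner elements of the quotient. *)
Lemma quotient_rank1_ideal :
  (exists (x : A) r u v, [/\ r != t, val x = rank1 r u v & q x != 0]) ->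
  exists L : csubalg Q, liminal_ideal L /\ exists z : Q, csubalg_set L z /\ z != 0.
Proof.
move=> [x0 [r0 [u0 [v0 [r0t x0E x0n]]]]].
pose S : set Q := [set z | exists (x : A) r u v,
  [/\ r != t, val x = rank1 r u v & z = q x]].
have [|||_ [x [r [u [v [rt xE ->]]]]]|L [LS limL]] := @cspan_liminal_ideal _ _ S.
- move=> a _ [x [r [u [v [rt xE ->]]]]]; have [b <-] := q_surj a.
  apply: sub_cspan; exists (cmul b x), r, (opf (val b) r u), v; split=> //.
  by rewrite -cmul_rank1 -xE.
- move=> a _ [x [r [u [v [rt xE ->]]]]]; have [b <-] := q_surj a.
  apply: sub_cspan; exists (cmul x b), r, u, (opf (adj (val b)) r v); split=> //.
  by rewrite -rank1_cmul -xE.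
- move=> _ [x [r [u [v [rt xE ->]]]]].
  apply: sub_cspan; exists (adj x), r, v, u; split=> //.
  by rewrite -adj_rank1 -xE.
- move=> y; have [b <-] := q_surj y; exists (hdot (opf (val b) r u) v).
  rewrite -!q_mul -qZ; congr q; apply: val_inj; rewrite linearZ/= xE.
  exact: rank1_corner.
exists L; split => //; exists (q x0); split => //.
by rewrite LS; apply: sub_cspan; exists x0, r0, u0, v0.
Qed.

(** If all rank-one operators vanish in the quotient, it is the closed span of
    orthogonal projections, each of which is a corner element. *)
Lemma quotient_comp1_ideal :
  (forall (x : A) r u v, r != t -> val x = rank1 r u v -> q x = 0) ->
  exists L : csubalg Q, liminal_ideal L /\ csubalg_set L = setT.
Proof.
move=> q1; pose S : set Q := [set z | exists (x : A) r, val x = comp1 H r /\ z = q x].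
have mulS (x y : A) r s : val x = comp1 H r -> val y = comp1 H s ->
    cmul x y = if r == s then x else 0.
  move=> xr ys; apply: val_inj; rewrite (fun_if val) raddf0 xr -comp1_mul -xr -ys.
  by [].
have ST : cspan S = setT.
  apply/seteqP; split => // z _; have [a <-] := q_surj z.
  move: a; apply: fiber_ind.
  - by apply: linear_preimage (cspan_lin _); exact: q_lin.
  - by apply: closed_preimage (@cspan_closed _ _ _); exact: q_continuous.
  - by move=> x r u v rt /(q1 _ _ _ _ rt) ->; exact: (subspace0 (cspan_lin _)).
  - by move=> x r xr; apply: sub_cspan; exists x, r.
have [|||_ [x [r [xr ->]]]|L [LS limL]] := @cspan_liminal_ideal _ _ S.
- by move=> a s _; rewrite ST.
- by move=> a s _; rewrite ST.
- by move=> s _; rewrite ST.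
- move=> y; have [b <-] := q_surj y; move: b; apply: fiber_ind.
  + apply: (linear_preimage (f := fun b => cmul (cmul (q x) (q b)) (q x)))
      (lin_subspace_line (q x)) => k b c.
    by rewrite q_lin cmull_linear cmulr_linear.
  + apply: (closed_preimage (f := fun b => cmul (cmul (q x) (q b)) (q x)))
      (closed_line (v := q x)) => b.
    apply: (@continuous_comp _ _ _ (fun b => cmul (q x) (q b)) (cmul^~ (q x))).
      apply: (@continuous_comp _ _ _ q (cmul (q x))); first exact: q_continuous.
      exact: cmull_continuous.
    exact: cmulr_continuous.
  + move=> b s u v st /(q1 _ _ _ _ st) /= ->.
    by exists 0; rewrite cmul0r cmul0l scale0r.
  + move=> b s bs /=; rewrite -!q_mul (mulS _ _ _ _ xr bs).
    have [_|_] := eqVneq r s; last by exists 0; rewrite cmul0l q0 scale0r.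
    by exists 1; rewrite (mulS _ _ _ _ xr xr) eqxx scale1r.
by exists L; split => //; rewrite LS.
Qed.

End Postliminal.

Lemma fiber_postliminal (R : realType) (I : eqType) (H : hilbertType R) (t : I) :
  postliminal (fiber H t).
Proof.
move=> J Q q idJ qJ [z z0].
have [h|h] := pselect (exists (x : fiber H t) r u v,
  [/\ r != t, val x = rank1 r u v & q x != 0]).
  exact: quotient_rank1_ideal qJ h.
have [|L [limL LT]] := quotient_comp1_ideal qJ idJ.
  move=> x r u v rt xE; apply/eqP/negPn/negP => x0; apply: h.
  by exists x, r, u, v.
by exists L; split => //; exists z; rewrite LT.
Qed.

(** * The fibers are isomorphic *)

Section Swap.
Variables (R : realType) (I : eqType) (H : hilbertType R).
Local Notation opfam := (opfam I H).

Variable sw : I -> I.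
Hypothesis swK : involutive sw.

Let perm_subproof (a : opfam) : (fun i u => opf a (sw i) u) \in @opfam_set R I H.
Proof.
apply/mem_set; split; first by exists (rnorm a) => i u; exact: opfam_rnormP.
by exists (fun i u => opf (adj a) (sw i) u) => i u v; exact: opfam_hdot_adj.
Qed.

Definition permute (a : opfam) : opfam :=
  exist _ (fun i u => opf a (sw i) u) (perm_subproof a).

Lemma permuteE a i u : opf (permute a) i u = opf a (sw i) u.
Proof. by []. Qed.

Lemma permuteK : involutive permute.
Proof. by move=> a; apply: opfam_ext => i u; rewrite !permuteE swK. Qed.

Lemma permute_lin (k : R[i]) a b : permute (k *: a + b) = k *: permute a + permute b.
Proof. exact: opfam_ext. Qed.

Lemma permute_mul a b : permute (cmul a b) = cmul (permute a) (permute b).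
Proof. exact: opfam_ext. Qed.

Lemma permute_adj a : permute (adj a) = adj (permute a).
Proof.
by apply/esym/opfam_adjE => i u v; rewrite !permuteE opfam_hdot_adj.
Qed.

Lemma permute_continuous : continuous permute.
Proof.
apply: (@rnorm_lipschitz_continuous _ _ _ _ 1) => a b; rewrite mul1r.
apply: opfam_rnorm_le => [|i u]; first exact: rnorm_ge0.
exact: opfam_rnormB.
Qed.

Lemma sw_eq i r : (sw i == r) = (i == sw r).
Proof. by apply/eqP/eqP => [<-|->]; rewrite swK. Qed.

Lemma permute_fiber t x :
  cspan (gens t) x -> cspan (gens (sw t)) (permute x).
Proof.
move: x; apply: cspan_ind.
- by apply: linear_preimage (cspan_lin _); exact: permute_lin.
- by apply: closed_preimage (@cspan_closed _ _ _); exact: permute_continuous.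
move=> _ [[r [u [v [rt ->]]]]|[r ->]]; apply: sub_cspan.
  left; exists (sw r), u, v; split; first by rewrite (inj_eq (can_inj swK)).
  by apply: opfam_ext => i w; rewrite permuteE !rank1E sw_eq.
by right; exists (sw r); apply: opfam_ext => i w; rewrite permuteE !comp1E sw_eq.
Qed.

Lemma permute_isomorphic s t : sw s = t -> isomorphic (fiber H s) (fiber H t).
Proof.
move=> st.
have fP (x : fiber H s) : csubalg_set (fiber_alg H t) (permute (val x)).
  by rewrite -st; apply: permute_fiber; exact: fiber_valP.
have gP (x : fiber H t) : csubalg_set (fiber_alg H s) (permute (val x)).
  have ts : sw t = s by rewrite -st swK.
  by have := permute_fiber (fiber_valP x); rewrite ts.
exists (fun x => csub_in (fP x)); split.
  split=> [k x y|x y|x]; apply: val_inj.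
  - rewrite [RHS]linearP; apply: etrans (permute_lin _ _ _).
    by apply: (congr1 permute); exact: linearP.
  - exact: permute_mul.
  - exact: permute_adj.
by exists (fun x => csub_in (gP x)) => x; apply: val_inj; rewrite /= permuteK.
Qed.

End Swap.

Lemma fiber_isomorphic (R : realType) (I : eqType) (H : hilbertType R) (s t : I) :
  isomorphic (fiber H s) (fiber H t).
Proof.
pose sw i := if i == s then t else if i == t then s else i.
apply: (@permute_isomorphic _ _ _ sw); last by rewrite /sw eqxx.
move=> i; rewrite /sw; have [->|is_] := eqVneq i s.
  by rewrite !eqxx; case: eqVneq => [->|].
have [->|it] := eqVneq i t; first by rewrite eqxx.
by rewrite (negbTE is_) (negbTE it).
Qed.

(** * Liminal ideals avoid the identity of an unrestricted component *)

Section ComponentRepresentation.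
Variables (R : realType) (I : eqType) (H : hilbertType R) (s r : I).
Variable L : csubalg (fiber H s).

Let p (x : csub L) : H -> H := opf (val (val x)) r.

Let p_continuous (x : csub L) : continuous (p x).
Proof.
apply: (@rnorm_lipschitz_continuous _ _ _ _ (rnorm (val (val x)))) => u v.
by rewrite -opfB; exact: opfam_rnormP.
Qed.

Let p_lin (k : R[i]) (x y : csub L) u : p (k *: x + y) u = k *: p x u + p y u.
Proof.
rewrite /p (csub_val_lin k x y).
by rewrite (@csub_val_lin _ _ (fiber_alg H s) k (val x) (val y)).
Qed.

Let p_linr (x : csub L) (k : R[i]) u v : p x (k *: u + v) = k *: p x u + p x v.
Proof. exact: opfam_lin. Qed.

Let p_mul (x y : csub L) u : p (cmul x y) u = p x (p y u).
Proof. exact: (opfam_cmulE (val (val x)) (val (val y))). Qed.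

Let p_adj (x : csub L) u v : hdot (p x u) v = hdot u (p (adj x) v).
Proof. exact: (opfam_hdot_adj (val (val x))). Qed.

Definition component_rep : representation (csub L) H :=
  @Representation R (csub L) H p p_linr p_continuous p_lin p_mul p_adj.

Lemma component_repE x u : component_rep x u = opf (val (val x)) r u.
Proof. by []. Qed.

(** If $yu\neq 0$, the ideal contains $\theta_{w,yu}\,y$, which maps $u$ to a
    nonzero multiple of the arbitrary vector $w$. *)
Lemma component_irreducible (y : fiber H s) :
  r != s -> closed_ideal L -> csubalg_set L y ->
  (forall u, u != 0 -> opf (val y) r u != 0) -> (exists u : H, u != 0) ->
  irreducible component_rep.
Proof.
move=> rs [_ Ll _ _] Ly y0 H0; split => // S lS _ pS.
have [[u [Su u0]]|S0] := pselect (exists u, S u /\ u != 0); last first.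
  left; apply/seteqP; split => [u Su|_ ->]; last exact: subspace0.
  by apply/eqP/negPn/negP => u0; apply: S0; exists u.
right; apply/seteqP; split => // w _.
pose v := opf (val y) r u.
pose a : fiber H s := fiber_in (gens_rank1 w v rs).
have La : csubalg_set L (cmul a y) by exact: Ll.
have := pS (csub_in La) u Su; rewrite component_repE.
have -> : opf (val (val (csub_in La))) r u = hdot v v *: w.
  rewrite -[val (val _)]/(cmul (rank1 r w v) (val y)).
  by rewrite opfam_cmulE rank1E eqxx.
move=> /(subspaceZ (hdot v v)^-1 lS); rewrite scalerA mulVf ?scale1r//.
rewrite hdot_rnorm; apply/negP => /eqP/complexI/eqP; rewrite sqrf_eq0 rnorm_eq0.
exact/negP/y0.
Qed.

End ComponentRepresentation.

(** An element close to the identity of component $r$ is bounded below there. So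
    it makes the component representation irreducible, and it sends an infinite
    separated sequence of the unit ball to a sequence that is still separated and
    cannot cluster. *)
Lemma liminal_far_from_comp1 (R : realType) (I : eqType) (H : hilbertType R)
    (e : nat -> H) (s r : I) (L : csubalg (fiber H s)) (y : fiber H s) :
  (forall n, rnorm (e n) <= 1) ->
  (forall m n, m != n -> 1 <= rnorm (e m - e n)) ->
  r != s -> liminal_ideal L -> csubalg_set L y ->
  4%:R^-1 <= rnorm (val y - comp1 H r).
Proof.
move=> e1 esep rs [idL limL] Ly; rewrite leNgt; apply/negP => yr.
have yid u : rnorm (opf (val y) r u - u) <= 4%:R^-1 * rnorm u.
  have := opfam_rnormB (val y) (comp1 H r) r u; rewrite comp1E eqxx.
  by move/le_trans; apply; rewrite ler_wpM2r ?rnorm_ge0// ltW.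
have ylow u : 3%:R / 4%:R * rnorm u <= rnorm (opf (val y) r u).
  have := yid u; have := rnormD (u - opf (val y) r u) (opf (val y) r u).
  by rewrite subrK rnormB; lra.
have y0 u : u != 0 -> opf (val y) r u != 0.
  rewrite -!rnorm_gt0 => u0; apply: lt_le_trans (ylow u); lra.
have H0 : exists u : H, u != 0.
  exists (e 0%N - e 1%N); rewrite -rnorm_gt0.
  by apply: lt_le_trans ltr01 (esep _ _ _).
have irr := component_irreducible rs idL Ly y0 H0.
have := limL H _ irr (csub_in Ly); rewrite /compact_operator precompactE.
pose x n := opf (val y) r (e n).
have xsep m n : m != n -> 3%:R / 4%:R <= rnorm (x m - x n).
  move=> mn; rewrite /x -opfB; apply: le_trans (ylow _).
  by have := esep m n mn; lra.
move=> /(_ (x @ \oo) _) [].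
  exists 0%N => // n _; apply: subset_closure; exists (e n) => //.
  by rewrite /= in_unit_ball.
move=> l [_ /= cl].
have near_l N : exists n, (N <= n)%N /\ rnorm (l - x n) < 4%:R^-1.
  have tailN : (x @ \oo) (x @` [set n | (N <= n)%N]).
    by exists N => // n /= Nn; exists n.
  have ballN : nbhs l [set z | rnorm (l - z) < 4%:R^-1].
    by apply/nbhs_rnormP; exists 4%:R^-1.
  by have [_ [[n /= Nn <-] ln]] := cl _ _ tailN ballN; exists n.
have [m [_ lm]] := near_l 0%N; have [n [mn ln]] := near_l m.+1.
have := xsep m n (negbT (ltn_eqF mn)).
have := rnorm_tri l (x m) (x n); rewrite (rnormB _ l); lra.
Qed.

(** In component $t$ the fiber has only scalars, so the multiples of the identity
    of that component form an ideal. *)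
Lemma comp1_liminal (R : realType) (I : eqType) (H : hilbertType R) (t : I) :
  exists L : csubalg (fiber H t), liminal_ideal L /\
    csubalg_set L (fiber_in (gens_comp1 H t t)).
Proof.
set c : fiber H t := fiber_in _.
have cc : cmul c c = c by apply: val_inj; have := comp1_mul H t t; rewrite eqxx.
have cl (a : fiber H t) : exists k : R[i], cmul a c = k *: c.
  move: a; apply: fiber_ind.
  - apply: (linear_preimage (f := fun a => cmul a c)) (lin_subspace_line c).
    exact: cmulr_linear.
  - apply: (closed_preimage (f := fun a => cmul a c)) (closed_line (v := c)).
    exact: cmulr_continuous.
  - move=> x r u v rt xE; exists 0; rewrite scale0r; apply: val_inj.
    rewrite raddf0; apply: opfam_ext => i w.
    rewrite -[val (cmul x c)]/(cmul (val x) (comp1 H t)) xE.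
    rewrite opfam_cmulE rank1E comp1E opfam0; case: (eqVneq i r) => // ->.
    by rewrite (negbTE rt) hdot0l scale0r.
  - move=> x r xE; exists (if r == t then 1 else 0); apply: val_inj.
    rewrite -[val (cmul x c)]/(cmul (val x) (comp1 H t)) xE comp1_mul.
    by case: eqVneq => [->|_]; rewrite ?scale1r// scale0r raddf0.
have adjc : adj c = c by apply: val_inj; exact: adj_comp1.
have cr (a : fiber H t) : exists k : R[i], cmul c a = k *: c.
  have [k ak] := cl (adj a); exists (Num.conj k).
  by rewrite -[LHS]adjK adjM adjc ak Defs.adjZ adjc.
have [||||L [LS limL]] := @cspan_liminal_ideal _ _ [set c].
- move=> a _ ->; have [k ->] := cl a.
  by apply: (subspaceZ _ (cspan_lin _)); exact: sub_cspan.
- move=> a _ ->; have [k ->] := cr a.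
  by apply: (subspaceZ _ (cspan_lin _)); exact: sub_cspan.
- by move=> _ ->; rewrite adjc; exact: sub_cspan.
- by move=> _ -> a; have [k ->] := cr a; exists k; rewrite cmulZl cc.
by exists L; split => //; rewrite LS; exact: sub_cspan.
Qed.

(** * The continuous field *)

Lemma subtype_nbhs (T : topologicalType) (U : set T) (t : U) (P : set U) :
  nbhs t P -> exists2 W, nbhs (set_val t) W & forall s : U, W (set_val s) -> P s.
Proof.
move=> [_ [[W oW <-] /= Wt WP]]; exists W; first exact: open_nbhs_nbhs.
by move=> s Ws; exact: WP.
Qed.

Section Field.
Variables (R : realType) (T : topologicalType) (H : hilbertType R).
Local Notation A := (fun t : T => fiber H t).

Definition sections : set (forall t, A t) :=
  [set x | continuous (fun t => val (x t) : opfam T H)].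

(** Continuous functions vanishing at $r$ turn rank-one operators in
    component $r$ into continuous sections. *)
Hypothesis separating : forall r t : T, r != t ->
  exists2 phi : T -> R, continuous phi & phi r = 0 /\ phi t = 1.

Lemma rank1_section (t : T) (x : A t) r u v :
  r != t -> val x = rank1 r u v -> exists2 g, sections g & g t = x.
Proof.
move=> /separating[phi phic [phir phit]] xE.
pose f s : opfam T H := (phi s)%:C%C *: rank1 r u v.
have fP s : csubalg_set (fiber_alg H s) (f s).
  rewrite /f; have [->|rs] := eqVneq s r.
    by rewrite phir scale0r; exact: (subspace0 (cspan_lin _)).
  apply: (subspaceZ _ (cspan_lin _)); apply: sub_cspan; apply: gens_rank1.
  by rewrite eq_sym.
exists (fun s => csub_in (fP s)); last first.
  by apply: val_inj; rewrite xE -[LHS]/(f t) /f phit scale1r.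
move=> s; apply/cvg_rnormP => d d0.
have n0 : 0 < rnorm (rank1 r u v) + 1 by rewrite ltr_wpDl ?rnorm_ge0.
have /cvgrPdist_lt/(_ _ (divr_gt0 d0 n0)) := phic s; apply: filterS => s'.
rewrite -[val _]/(f s) -[val (csub_in (fP s'))]/(f s') /f -scalerBl rnormZ.
rewrite -rmorphB cmod_real ltr_pdivlMr//; apply: le_lt_trans.
by rewrite ler_wpM2l// lerDl.
Qed.

Lemma comp1_section (t : T) (x : A t) r :
  val x = comp1 H r -> exists2 g, sections g & g t = x.
Proof.
move=> xE; exists (fun s => fiber_in (gens_comp1 H s r)).
  by move=> s; exact: cvg_cst.
by apply: val_inj; rewrite xE.
Qed.

Lemma sections_lin (k : R[i]) x y : sections x -> sections y ->
  sections (fun t => k *: x t + y t).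
Proof.
move=> xc yc t; apply/cvg_rnormP => e e0.
have k0 : 0 < cmod k + 1 by rewrite ltr_wpDl ?cmod_ge0.
have e2 : 0 < e / 2 by rewrite divr_gt0.
have /cvg_rnormP/(_ _ (divr_gt0 e2 k0)) := xc t.
have /cvg_rnormP/(_ _ e2) := yc t; apply: filterS2 => s ys xs.
rewrite (@csub_val_lin _ _ (fiber_alg H t)) (@csub_val_lin _ _ (fiber_alg H s)).
rewrite opprD addrACA -scalerBr.
apply: le_lt_trans (rnormD _ _) _; rewrite rnormZ.
move: xs; rewrite ltr_pdivlMr//.
by have := rnorm_ge0 (val (x t) - val (x s)); lra.
Qed.

Lemma sections_mul x y : sections x -> sections y ->
  sections (fun t => cmul (x t) (y t)).
Proof.
move=> xc yc t; apply/cvg_rnormP => e e0.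
set a := val (x t); set b := val (y t).
have a0 : 0 < rnorm a + 1 by rewrite ltr_wpDl ?rnorm_ge0.
have b0 : 0 < rnorm b + 1 by rewrite ltr_wpDl ?rnorm_ge0.
have e2 : 0 < e / 2 by rewrite divr_gt0.
have /cvg_rnormP/(_ _ (divr_gt0 e2 b0)) := xc t.
have m0 : 0 < Num.min 1 (e / 2 / (rnorm a + 1)).
  by rewrite lt_min ltr01 divr_gt0.
have /cvg_rnormP/(_ _ m0) := yc t; apply: filterS2 => s.
rewrite lt_min -/a -/b !ltr_pdivlMr// => /andP[ys1 ys] xs.
rewrite -[val (cmul (x t) (y t))]/(cmul a b).
rewrite -[val _]/(cmul (val (x s)) (val (y s))).
move: (val (x s)) (val (y s)) => a' b' in ys1 ys xs *.
have -> : cmul a b - cmul a' b' = cmul a (b - b') + cmul (a - a') b'.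
  by rewrite cmulBr cmulBl addrA subrK.
have b'1 : rnorm b' <= rnorm b + 1.
  have := rnormD (b' - b) b; rewrite subrK rnormB; lra.
apply: le_lt_trans (rnormD _ _) _.
have h1 := rnormM a (b - b'); have h2 := rnormM (a - a') b'.
have h3 : rnorm (a - a') * rnorm b' <= rnorm (a - a') * (rnorm b + 1).
  by rewrite ler_wpM2l ?rnorm_ge0.
have := rnorm_ge0 (b - b'); lra.
Qed.

Lemma sections_adj x : sections x -> sections (fun t => adj (x t)).
Proof.
move=> xc t; apply/cvg_rnormP => e e0.
have /cvg_rnormP/(_ _ e0) := xc t; apply: filterS => s.
by rewrite -rnorm_adj adjB.
Qed.

(** Uniform limits of continuous functions are continuous. *)
Lemma sections_local : locally_approx sections `<=` sections.
Proof.
move=> x xloc t; apply/cvg_rnormP => e e0.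
have e4 : 0 < e / 4%:R by rewrite divr_gt0.
have [y [yc xy]] := xloc t _ e4.
have yt := nbhs_singleton xy; rewrite /= (@csub_rnormB _ _ (fiber_alg H t)) in yt.
have /cvg_rnormP/(_ _ e4) := yc t; apply: filterS2 xy => s xs ys.
rewrite (@csub_rnormB _ _ (fiber_alg H s)) in xs.
exact: (rnorm_tri4 e0 yt xs ys).
Qed.

Lemma sections_dense (t : T) : dense [set x t | x in sections].
Proof.
pose W : set (fiber H t) := [set a | forall e : R, 0 < e ->
  exists2 x, sections x & rnorm (a - x t) < e].
suff h a : W a.
  by apply: dense_rnormP => a e /(h a)[x xc ax]; exists (x t) => //; exists x.
move: a; apply: fiber_ind.
- split=> [e e0|k a b ha hb e e0].
    exists (fun s => 0); last by rewrite subr0 rnorm0.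
    by move=> s; exact: cvg_cst.
  have k0 : 0 < cmod k + 1 by rewrite ltr_wpDl ?cmod_ge0.
  have e2 : 0 < e / 2 by rewrite divr_gt0.
  have [x xc ax] := ha _ (divr_gt0 e2 k0); have [y yc bY] := hb _ e2.
  exists (fun s => k *: x s + y s); first exact: sections_lin.
  rewrite opprD addrACA -scalerBr; apply: le_lt_trans (rnormD _ _) _; rewrite rnormZ.
  move: ax; rewrite ltr_pdivlMr//.
  by have := rnorm_ge0 (a - x t); lra.
- apply/closed_rnormP => a h e e0; have e2 : 0 < e / 2 by rewrite divr_gt0.
  have [b hb ab] := h _ e2; have [x xc bx] := hb _ e2; exists x => //.
  by apply: le_lt_trans (rnorm_tri b _ _) _; lra.
- move=> x r u v rt xE e e0; have [g gc gx] := rank1_section rt xE.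
  by exists g => //; rewrite gx subrr rnorm0.
- move=> x r xE e e0; have [g gc gx] := comp1_section xE.
  by exists g => //; rewrite gx subrr rnorm0.
Qed.

Lemma sections_field : continuous_field sections.
Proof.
split.
- by move=> s; exact: cvg_cst.
- exact: sections_lin.
- exact: sections_mul.
- exact: sections_adj.
- exact: sections_dense.
- by move=> x xc; exact: (continuous_rnorm xc).
- exact: sections_local.
Qed.

(** A section of the greatest liminal ideals passing near the identity of
    component $t$ at $t$ would stay near it at some $s\neq t$. *)
Lemma sections_not_tame (e : nat -> H) (U : set T) (t : T) :
  (forall n, rnorm (e n) <= 1) ->
  (forall m n, m != n -> 1 <= rnorm (e m - e n)) ->
  U t -> (forall W, nbhs t W -> exists s, [/\ U s, W s & s != t]) ->
  ~ tame (restriction sections U).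
Proof.
move=> e1 esep Ut isolated [B [Bmax Bfield]].
pose t' : U := SigSub (mem_set Ut).
have [L [limL Lc]] := comp1_liminal H t.
set c : fiber H t := fiber_in _ in Lc.
have Bc : csubalg_set (B t') c by apply: (Bmax t').2 Lc.
(* Four errors of this size add up to less than the distance 1/4 of
   liminal_far_from_comp1. *)
pose d : R := 16%:R^-1; have d0 : 0 < d by rewrite invr_gt0.
have [_ [x /= xB <-] cx] := dense_rnorm (cfield_dense Bfield (t := t')) (csub_in Bc) d0.
have [_ [[g gc <-] near_g]] := xB t' d d0.
have g_t := nbhs_singleton near_g.
have /cvg_rnormP/(_ _ d0) g_cont := gc t.
have [W Wt WP] := subtype_nbhs near_g.
have [s [Us [Ws gs] st]] := isolated _ (filterI Wt g_cont).
pose s' : U := SigSub (mem_set Us).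
have xs := WP s' Ws.
have Bxs : csubalg_set (B s') (val (x s')) by exact: csub_valP.
have := liminal_far_from_comp1 e1 esep _ (Bmax s').1 Bxs.
move=> /(_ t); rewrite eq_sym => /(_ st); apply/negP; rewrite -ltNge.
rewrite (@csub_rnormB _ _ (fiber_alg H s)) in xs.
rewrite (@csub_rnormB _ _ (fiber_alg H t)) in g_t.
rewrite (@csub_rnormB _ _ (B t')) (@csub_rnormB _ _ (fiber_alg H t)) rnormB in cx.
rewrite rnormB in gs; rewrite rnormB in g_t.
have -> : 4%:R^-1 = 4 * d by rewrite /d; field.
exact: rnorm_chain4 xs gs g_t cx.
Qed.

End Field.

(** * The field over the unit interval *)

Lemma interval_separating (R : realType) (r t : `[0%R, 1%R : R]%classic) :
  r != t -> exists2 phi : `[0%R, 1%R : R]%classic -> R,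
    continuous phi & phi r = 0 /\ phi t = 1.
Proof.
move=> rt; have rt0 : set_val t - set_val r != 0.
  rewrite subr_eq0; apply: contra rt => /eqP trE.
  by apply/eqP/esym; apply: val_inj.
pose f (x : R) := (x - set_val r) / (set_val t - set_val r).
exists (f \o set_val); last by rewrite /f /= subrr mul0r divff.
have fc : continuous f.
  move=> x; apply: cvgM; last exact: cvg_cst.
  by apply: cvgB; [exact: cvg_id|exact: cvg_cst].
move=> s; apply: continuous_comp; last exact: fc.
exact: (@initial_continuous `[0%R, 1%R : R]%classic R set_val s).
Qed.

Lemma interval_not_isolated (R : realType) (t : `[0%R, 1%R : R]%classic)
    (W : set `[0%R, 1%R : R]%classic) : nbhs t W -> exists2 s, W s & s != t.
Proof.
move=> /subtype_nbhs[V /nbhs_ballP[d /= d0 dV] VW].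
have /andP[t0 t1] : 0 <= set_val t <= 1 by have := set_valP t; rewrite /= in_itv.
have [h h0 [hd h2]] : exists2 h : R, 0 < h & h < d /\ h <= 2^-1.
  exists (Num.min (d / 2) (2^-1)); first by rewrite lt_min divr_gt0//= invr_gt0.
  split; last by rewrite ge_min lexx orbT.
  by rewrite gt_min; apply/orP; left; lra.
pose s0 : R := if set_val t <= 2^-1 then set_val t + h else set_val t - h.
have s01 : `[0%R, 1%R : R]%classic s0.
  rewrite /= in_itv/= /s0; move: (set_val t) t0 t1 => a a0 a1.
  by have [al|al] := lerP a 2^-1; apply/andP; split; lra.
have s0t : `|set_val t - s0| = h.
  rewrite /s0; case: ifP => _; last by rewrite opprB addrC subrK ger0_norm// ltW.
  by rewrite opprD addrA subrr sub0r normrN ger0_norm// ltW.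
exists (SigSub (mem_set s01)).
  by apply: VW; apply: dV; rewrite /ball/= -[set_val (SigSub _)]/s0 s0t.
apply/eqP => st; move: s0t; rewrite -st -[set_val (SigSub _)]/s0 subrr normr0.
by move=> h00; rewrite -h00 ltxx in h0.
Qed.

Theorem mainTheorem3 (R : realType) :
  exists (A : `[0%R, 1%R : R]%classic -> cstarAlgType R)
         (G : set (forall t, A t)),
    continuous_field G /\
    (forall t, postliminal (A t)) /\
    (forall s t, isomorphic (A s) (A t)) /\
    (forall U : set `[0%R, 1%R : R]%classic, open U -> U !=set0 ->
       ~ tame (restriction G U)).
Proof.
have [e [e1 esep]] := ell2_separated R.
exists (fun t => fiber (ell2 R) t), (@sections R _ (ell2 R)); split; last split; last split.
- exact: sections_field (@interval_separating R).
- by move=> t; exact: fiber_postliminal.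
- by move=> s t; exact: fiber_isomorphic.
move=> U Uo [t Ut]; apply: (sections_not_tame e1 esep Ut) => W tW.
have tU : nbhs t U by exact: open_nbhs_nbhs.
have [s [Ws Us] st] := interval_not_isolated (filterI tW tU).
by exists s.
Qed.
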